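(* An element $a\in\mathcal{A}=\ell^1(\mathbb{H},\mathbb{C})$ is invertible if and only if there exists, for every $\theta\in\mathbb{S}$, an element $b_\theta\in\mathcal{A}$ such that $$(a+\mathcal{J}_\theta)\cdot(b_\theta+\mathcal{J}_\theta)=1+\mathcal{J}_\theta$$ in $\mathcal{A}/\mathcal{J}_\theta$ or, equivalently, $(ab_\theta-1)\in\mathcal{J}_\theta$, or $1\in a\cdot\mathcal{A}+\mathcal{J}_\theta$.
   Context: $\mathbb{H}$ is the discrete Heisenberg group of upper triangular unipotent integer $3\times3$ matrices, with standard generators $x,y$ (ones in position $(1,2)$, resp. $(2,3)$) and central element $z=xyx^{-1}y^{-1}$ generating the center; every element of $\mathbb{H}$ is uniquely $x^ky^lz^m$ with $(k,l,m)\in\mathbb{Z}^3$. $\ell^1(\mathbb{H},\mathbb{C})$ is the Banach algebra with convolution product; its elements are written $f=\sum_{(k,l,m)}f_{(k,l,m)}x^ky^lz^m$. $\mathbb{S}=\{\theta\in\mathbb{C}:|\theta|=1\}$ is identified with the space of maximal ideals of the center $\ell^1(C(\mathbb{H}),\mathbb{C})\cong\ell^1(\mathbb{Z},\mathbb{C})$, with $\theta$ corresponding to $m_\theta=\{h\in\ell^1(\mathbb{Z},\mathbb{C}):\sum_nh_n\theta^n=0\}$. $\mathcal{J}_\theta$ is the smallest closed two-sided ideal of $\mathcal{A}$ containing $m_\theta$; explicitly, $\mathcal{J}_\theta$ is the set of all $f\in\ell^1(\mathbb{H},\mathbb{C})$ with $\sum_{m\in\mathbb{Z}}f_{(k,l,m)}\theta^m=0$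 for every $(k,l)\in\mathbb{Z}^2$. *)

(* Defs.v *)
From HB Require Import structures.
From mathcomp Require Import all_boot all_order all_algebra finmap complex ring lra.
From mathcomp Require Import generic_quotient ring_quotient.
From mathcomp Require Import all_classical all_reals all_analysis.
From mathcomp.analysis.showcase Require summability.

Set Implicit Arguments.
Unset Strict Implicit.
Unset Printing Implicit Defensive.
Import Order.TTheory GRing.Theory Num.Theory.
Import numFieldNormedType.Exports.
Local Open Scope classical_set_scope.
Local Open Scope ring_scope.

#[export] Existing Instance summability.totally_filter.

(* The modulus, as an element of R: the norm `|x| of R[i] lives in R[i]. *)
Definition nrm (R : realType) (x : R[i]) : R := complex.Re `|x|.

(* Unordered sum: limit of the finite partial sums along the directed set of
   finite subsets of I. R[i]^o is R[i] with its topology. *)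
Definition csum (R : realType) (I : choiceType) (f : I -> R[i]) : R[i] :=
  summability.sum (f : I -> R[i]^o).

Definition csummable (R : realType) (I : choiceType) (f : I -> R[i]) : bool :=
  summable [set: I] (fun i => (nrm (f i))%:E).

Section Nrm.
Variable R : realType.
Implicit Types x y : R[i].

Lemma nrmE x : `|x| = (nrm x)%:C%C.
Proof. by rewrite /nrm normc_def. Qed.

Lemma nrm_ge0 x : 0 <= nrm x.
Proof. by rewrite -ler0c -nrmE. Qed.

Lemma nrm0 : nrm (0 : R[i]) = 0.
Proof. by rewrite /nrm normr0. Qed.

Lemma nrm_eq0 x : nrm x = 0 -> x = 0.
Proof. by move=> x0; apply/normr0_eq0; rewrite nrmE x0. Qed.

Lemma nrmD x y : nrm (x + y) <= nrm x + nrm y.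
Proof. by rewrite -lecR rmorphD /= -!nrmE ler_normD. Qed.

Lemma nrmM x y : nrm (x * y) = nrm x * nrm y.
Proof. by apply/complexI; rewrite rmorphM /= -!nrmE normrM. Qed.

Lemma nrmN x : nrm (- x) = nrm x.
Proof. by rewrite /nrm normrN. Qed.

Lemma nrmB x y : nrm (x - y) = nrm (y - x).
Proof. by rewrite -nrmN opprB. Qed.

Lemma nrm_real (r : R) : 0 <= r -> nrm (r%:C%C) = r.
Proof. by move=> r0; rewrite /nrm ger0_norm // ler0c. Qed.

Lemma nrm_sum (I : Type) (s : seq I) (f : I -> R[i]) :
  nrm (\sum_(i <- s) f i) <= \sum_(i <- s) nrm (f i).
Proof.
elim: s => [|a s IH]; first by rewrite !big_nil nrm0.
by rewrite !big_cons (le_trans (nrmD _ _))// lerD2l.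
Qed.

End Nrm.

Section Sums.
Variable R : realType.
Local Open Scope fset_scope.
Local Open Scope ring_scope.

Definition has_csum (I : choiceType) (f : I -> R[i]) (s : R[i]) :=
  forall e : R, 0 < e -> exists A : {fset I}, forall B : {fset I},
    A `<=` B -> nrm (\sum_(i <- B) f i - s) < e.

Lemma has_csum_cvg (I : choiceType) (f : I -> R[i]) s :
  has_csum f s ->
  summability.partial_sum (f : I -> R[i]^o) @ summability.totally --> (s : R[i]^o).
Proof.
move=> fs; apply/cvgrPdist_lt => e e0.
have eR : e = (nrm e)%:C%C by rewrite -nrmE gtr0_norm.
have ne0 : 0 < nrm e by rewrite -ltcR -eR.
have [A HA] := fs _ ne0.
exists A => // B /= AB; rewrite distrC nrmE eR ltcR /summability.partial_sum.
by rewrite -(big_seq_fsetE _ _ xpredT); exact: HA.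
Qed.

Lemma csumE (I : choiceType) (f : I -> R[i]) s : has_csum f s -> csum f = s.
Proof. by move/has_csum_cvg => h; apply: (cvg_lim (@norm_hausdorff _ _) h). Qed.

Lemma has_csum_uniq (I : choiceType) (f : I -> R[i]) s t :
  has_csum f s -> has_csum f t -> s = t.
Proof. by move=> /csumE <- /csumE <-. Qed.

Lemma ler_sum_fset (I : choiceType) (f : I -> R) (A B : {fset I}) :
  (forall i, 0 <= f i) -> A `<=` B -> \sum_(i <- A) f i <= \sum_(i <- B) f i.
Proof.
move=> f0 /fsubsetP AB; rewrite [leRHS](bigID (mem A)) /=.
rewrite (_ : \sum_(i <- B | i \in A) f i = \sum_(i <- A) f i) ?lerDl ?sumr_ge0//.
rewrite -big_filter; apply: perm_big; apply: uniq_perm; rewrite ?filter_uniq//.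
by move=> i; rewrite mem_filter andb_idr//; exact: AB.
Qed.

Lemma csummableP (I : choiceType) (f : I -> R[i]) :
  csummable f <-> exists M, forall A : {fset I}, \sum_(i <- A) nrm (f i) <= M.
Proof.
rewrite /csummable /summable.
have -> : (\esum_(x in [set: I]) `|(nrm (f x))%:E|)%E =
          \esum_(x in [set: I]) (nrm (f x))%:E.
  by apply: eq_esum => i _; rewrite gee0_abs// lee_fin nrm_ge0.
split.
  move=> foo; exists (fine (\esum_(x in [set: I]) (nrm (f x))%:E)) => A.
  rewrite -lee_fin fineK; last first.
    by rewrite ge0_fin_numE// esum_ge0// => i _; rewrite lee_fin nrm_ge0.
  apply: ereal_sup_ubound; exists [set` A] => //=.
  by rewrite fsbig_finite//= set_fsetK sumEFin.
move=> [M HM]; apply: (@le_lt_trans _ _ M%:E); last exact: ltry.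
apply: ge_ereal_sup => _ [X [Xfin _] <-].
by rewrite fsbig_finite//= sumEFin lee_fin.
Qed.

Lemma has_csum_ge0 (I : choiceType) (f : I -> R) :
  (forall i, 0 <= f i) -> csummable (fun i => (f i)%:C%C) ->
  exists s : R, 0 <= s /\ has_csum (fun i => (f i)%:C%C) s%:C%C.
Proof.
move=> f0 /csummableP[M HM].
pose S := [set x | exists A : {fset I}, x = \sum_(i <- A) f i].
have HM' (A : {fset I}) : \sum_(i <- A) f i <= M.
  by rewrite (le_trans _ (HM A))// ler_sum// => i _; rewrite nrm_real.
have hS : has_sup S.
  split; first by exists (\sum_(i <- fset0) f i), fset0.
  by exists M => _ [A ->].
exists (sup S); split.
  apply: ub_le_sup; first by case: hS.
  by exists fset0; rewrite big_seq_fset0.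
move=> e e0.
have [_ [A ->] hA] := sup_adherent e0 hS.
exists A => B AB; rewrite -rmorph_sum /= nrmB -rmorphB/=.
have leS : \sum_(i <- B) f i <= sup S.
  by apply: ub_le_sup; [case: hS|exists B].
rewrite nrm_real ?subr_ge0// ltrBlDl -ltrBlDr (lt_le_trans hA)//.
exact: ler_sum_fset.
Qed.

Lemma has_csum_ext (I : choiceType) (f g : I -> R[i]) s :
  f =1 g -> has_csum f s -> has_csum g s.
Proof. by move/funext => ->. Qed.

Lemma has_csumD (I : choiceType) (f g : I -> R[i]) s t :
  has_csum f s -> has_csum g t -> has_csum (fun i => f i + g i) (s + t).
Proof.
move=> fs gt e e0; have e20 : 0 < e / 2 by rewrite divr_gt0.
have [A HA] := fs _ e20; have [B HB] := gt _ e20.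
exists (A `|` B) => C; rewrite fsubUset => /andP[AC BC].
rewrite big_split/= opprD addrACA (splitr e).
by rewrite (le_lt_trans (nrmD _ _))// ltrD ?HA ?HB.
Qed.

Lemma has_csumZ (I : choiceType) (f : I -> R[i]) s c :
  has_csum f s -> has_csum (fun i => c * f i) (c * s).
Proof.
move=> fs e e0.
have c1 : 0 < nrm c + 1 by rewrite ltr_wpDl ?nrm_ge0.
have [|A HA] := fs (e / (nrm c + 1)); first by rewrite divr_gt0.
exists A => B /HA; rewrite -mulr_sumr -mulrBr nrmM ltr_pdivlMr// mulrC.
by apply: le_lt_trans; rewrite ler_wpM2r ?nrm_ge0// lerDl.
Qed.

Lemma csummable_le (I : choiceType) (f g : I -> R[i]) :
  (forall i, nrm (f i) <= nrm (g i)) -> csummable g -> csummable f.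
Proof.
move=> fg /csummableP[M HM]; apply/csummableP; exists M => A.
by rewrite (le_trans _ (HM A))// ler_sum.
Qed.

Lemma csummableD (I : choiceType) (f g : I -> R[i]) :
  csummable f -> csummable g -> csummable (fun i => f i + g i).
Proof.
move=> /csummableP[M HM] /csummableP[N HN]; apply/csummableP.
exists (M + N) => A; rewrite (le_trans _ (lerD (HM A) (HN A)))//.
by rewrite -big_split ler_sum// => i _; exact: nrmD.
Qed.

Lemma csummableZ (I : choiceType) (f : I -> R[i]) c :
  csummable f -> csummable (fun i => c * f i).
Proof.
move=> /csummableP[M HM]; apply/csummableP; exists (nrm c * M) => A.
rewrite (eq_bigr (fun i => nrm c * nrm (f i))) => [|i _]; last exact: nrmM.
by rewrite -mulr_sumr ler_wpM2l// nrm_ge0.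
Qed.

Lemma nrm_Re (x : R[i]) : `|complex.Re x| <= nrm x.
Proof. by rewrite -lecR -nrmE normc_ge_Re. Qed.

Lemma nrm_Im (x : R[i]) : `|complex.Im x| <= nrm x.
Proof.
rewrite /nrm normc_def /= -sqrtr_sqr ler_wsqrtr// lerDr sqr_ge0//.
Qed.

Lemma csummable_has_csum (I : choiceType) (f : I -> R[i]) :
  csummable f -> has_csum f (csum f).
Proof.
move=> fS; suff [s fs] : exists s, has_csum f s by rewrite (csumE fs).
have key (g : R[i] -> R) : (forall x, `|g x| <= nrm x) ->
    exists s, has_csum (fun i => (g (f i))%:C%C) s.
  move=> gn.
  have h (h : R[i] -> R) : (forall x, 0 <= h x <= nrm x) ->
      exists s, has_csum (fun i => (h (f i))%:C%C) s.
    move=> hn; have [i||s [_ hs]] := @has_csum_ge0 _ (fun i => h (f i)); last by exists s%:C%C.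
    - by case/andP: (hn (f i)).
    - apply: csummable_le fS => i; case/andP: (hn (f i)) => h0 h1.
      by rewrite nrm_real.
  have [|s hs] := h (fun x => Num.max (g x) 0).
    by move=> x; rewrite le_max lexx orbT ge_max nrm_ge0 (le_trans (ler_norm _)).
  have [|t ht] := h (fun x => Num.max (- g x) 0).
    move=> x; rewrite le_max lexx orbT ge_max nrm_ge0.
    by rewrite (le_trans (ler_norm _))// normrN.
  exists (s + (-1) * t); apply: has_csum_ext (has_csumD hs (has_csumZ (-1) ht)).
  move=> i /=; rewrite mulN1r -rmorphB /=; congr (_%:C%C).
  by case: (leP (g (f i)) 0) => ?; case: (leP (- g (f i)) 0) => ?; lra.
have [s hs] := key (@complex.Re R) nrm_Re.
have [t ht] := key (@complex.Im R) nrm_Im.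
exists (s + 'i%C * t); apply: has_csum_ext (has_csumD hs (has_csumZ 'i%C ht)).
by move=> i /=; rewrite -complexE.
Qed.

Lemma has_csum_common (I J : choiceType) (F : I -> J -> R[i]) g (B : {fset I}) e :
  0 < e -> (forall i, has_csum (F i) (g i)) ->
  exists A : {fset J}, forall C : {fset J}, A `<=` C ->
    forall i, i \in B -> nrm (\sum_(j <- C) F i j - g i) < e.
Proof.
move=> e0 Fg; have /choice[A HA] := fun i => Fg i e e0.
exists (\bigcup_(i <- B) A i) => C /bigfcupsP AC i iB.
by apply: HA; apply: AC.
Qed.

Lemma sum_fsetM (V : nmodType) (I J : choiceType) (A : {fset I}) (B : {fset J})
    (F : I -> J -> V) :
  \sum_(p <- (A `*` B)%fset) F p.1 p.2 = \sum_(i <- A) \sum_(j <- B) F i j.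
Proof.
rewrite -(big_allpairs (r1 := A) (r2 := B) (F := fun p => F p.1 p.2)).
apply: perm_big; apply: uniq_perm; rewrite ?fset_uniq//.
  by apply: allpairs_uniq; rewrite ?fset_uniq// => -[? ?] [? ?].
move=> [i j]; rewrite in_fsetM /=; apply/andP/allpairsP => /=.
  by move=> [iA jB]; exists (i, j).
by move=> [[i' j'] /= [? ? [-> ->]]].
Qed.

Lemma has_csum_fubini (I J : choiceType) (F : I -> J -> R[i]) g s :
  has_csum (fun p => F p.1 p.2) s -> (forall i, has_csum (F i) (g i)) ->
  has_csum g s.
Proof.
move=> Fs Fg e e0; have e20 : 0 < e / 2 by rewrite divr_gt0.
have [A HA] := Fs _ e20.
exists [fset p.1 | p in A] => B AB.
pose d := e / 2 / (size B).+1%:R.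
have d0 : 0 < d by rewrite divr_gt0.
have [C HC] := has_csum_common B d0 Fg.
pose D := C `|` [fset p.2 | p in A].
have AD : A `<=` B `*` D.
  apply/fsubsetP => p pA; rewrite in_fsetM; apply/andP; split.
    by move/fsubsetP: AB; apply; apply/imfsetP; exists p.
  by rewrite inE; apply/orP; right; apply/imfsetP; exists p.
have {HA} := HA _ AD; rewrite sum_fsetM => HA.
set T := (X in nrm (X - s)) in HA.
rewrite -(subrK T (\sum_(i <- B) g i)) -addrA (splitr e).
rewrite (le_lt_trans (nrmD _ _))// ler_ltD// /T -sumrB.
rewrite (le_trans (nrm_sum _ _))//.
apply: (@le_trans _ _ (\sum_(i <- B) d)).
  rewrite big_seq [leRHS]big_seq ler_sum// => i iB.
  by rewrite nrmB ltW// HC// fsubsetUl.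
rewrite big_const_seq count_predT iter_addr_0 -[leLHS]mulr_natr /d mulrAC.
by rewrite ler_pdivrMr// ler_wpM2l ?ler_nat// ltW.
Qed.

Lemma sum_bij (V : nmodType) (I J : choiceType) (h : I -> J) (A : {fset I})
   (f : J -> V) : injective h ->
  \sum_(j <- [fset h i | i in A]) f j = \sum_(i <- A) f (h i).
Proof.
move=> hi; rewrite -(big_map h xpredT f); apply: perm_big.
apply: uniq_perm; rewrite ?fset_uniq ?map_inj_uniq ?fset_uniq//.
move=> j; apply/imfsetP/mapP => /= -[i iA ->]; by exists i.
Qed.

Lemma has_csum_bij (I J : choiceType) (h : I -> J) (k : J -> I)
   (f : J -> R[i]) s : cancel h k -> cancel k h ->
  has_csum (fun i => f (h i)) s -> has_csum f s.
Proof.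
move=> hk kh fs e e0; have [A HA] := fs e e0.
exists [fset h i | i in A] => B AB.
have -> : \sum_(i <- B) f i = \sum_(i <- [fset k j | j in B]) f (h i).
  rewrite sum_bij; last exact: can_inj kh.
  by apply: eq_bigr => j _; rewrite kh.
apply: HA; apply/fsubsetP => i iA; apply/imfsetP; exists (h i) => //=.
by move/fsubsetP: AB; apply; apply/imfsetP; exists i.
Qed.

Lemma has_csum_fubini2 (I J : choiceType) (F : I -> J -> R[i]) g h :
  csummable (fun p => F p.1 p.2) -> (forall i, has_csum (F i) (g i)) ->
  (forall j, has_csum (F^~ j) (h j)) -> exists s, has_csum g s /\ has_csum h s.
Proof.
move=> /csummable_has_csum; move: (csum _) => s Fs Fg Fh; exists s; split.
  exact: has_csum_fubini Fs Fg.
apply: has_csum_fubini (Fh).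
by apply: (has_csum_bij (h := fun p => (p.2, p.1)) (k := fun p => (p.2, p.1)));
  [case|case|exact: Fs].
Qed.

Lemma csummable_rows (I J : choiceType) (F : I -> J -> R[i]) g :
  csummable (fun p => F p.1 p.2) -> (forall i, has_csum (F i) (g i)) ->
  csummable g.
Proof.
move=> /csummableP[M HM] Fg; apply/csummableP; exists (M + 1) => B.
pose d : R := (size B).+1%:R^-1.
have d0 : 0 < d by rewrite invr_gt0.
have [C HC] := has_csum_common B d0 Fg.
apply: (@le_trans _ _ (\sum_(i <- B) (\sum_(j <- C) nrm (F i j) + d))).
  rewrite big_seq [leRHS]big_seq ler_sum// => i iB.
  rewrite -[X in nrm X](subrK (\sum_(j <- C) F i j)) addrC.
  by rewrite (le_trans (nrmD _ _))// lerD ?nrm_sum// nrmB ltW// HC.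
rewrite big_split lerD//; first by rewrite -(sum_fsetM _ _ (fun i j => nrm (F i j))) HM.
rewrite big_const_seq count_predT iter_addr_0 -[leLHS]mulr_natr /d.
by rewrite ler_pdivrMl// mulr1 ler_nat.
Qed.

Lemma csummableM (I J : choiceType) (f : I -> R[i]) (g : J -> R[i])
    (k : I -> J -> J) : (forall i, injective (k i)) ->
  csummable f -> csummable g -> csummable (fun p => f p.1 * g (k p.1 p.2)).
Proof.
move=> ki /csummableP[M HM] /csummableP[N HN]; apply/csummableP.
exists (M * N) => A.
have N0 : 0 <= N by rewrite (le_trans _ (HN fset0))// big_seq_fset0.
have /ler_sum_fset H : A `<=` [fset p.1 | p in A] `*` [fset p.2 | p in A].
  apply/fsubsetP => p pA; rewrite in_fsetM.
  by apply/andP; split; apply/imfsetP; exists p.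
apply: le_trans (H _ _) _ => [p|]; first exact: nrm_ge0.
rewrite (sum_fsetM _ _ (fun i j => nrm (f i * g (k i j)))).
apply: (@le_trans _ _ (\sum_(i <- [fset p.1 | p in A]) nrm (f i) * N)); last first.
  by rewrite -mulr_suml ler_wpM2r.
rewrite ler_sum// => i _.
under eq_bigr do rewrite nrmM.
rewrite -mulr_sumr ler_wpM2l ?nrm_ge0//.
by rewrite -(sum_bij _ (fun j => nrm (g j)) (ki i)).
Qed.

Lemma has_csum1 (I : choiceType) (f : I -> R[i]) i0 :
  (forall i, i != i0 -> f i = 0) -> has_csum f (f i0).
Proof.
move=> f0 e e0; exists [fset i0] => B; rewrite fsub1set => iB.
rewrite (big_rem i0)//= big_seq big1 ?addr0 ?subrr ?nrm0// => i.
by rewrite mem_rem_uniq// inE => /andP[/f0].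
Qed.

Lemma csummable1 (I : choiceType) (f : I -> R[i]) i0 :
  (forall i, i != i0 -> f i = 0) -> csummable f.
Proof.
move=> f0; apply/csummableP; exists (nrm (f i0)) => A.
have [iA|niA] := boolP (i0 \in A).
  rewrite (big_rem i0)//= big_seq big1 ?addr0// => i.
  by rewrite mem_rem_uniq// inE => /andP[/f0 ->]; rewrite nrm0.
rewrite big_seq big1 ?nrm_ge0// => i iA; rewrite f0 ?nrm0//.
by apply: contraNneq niA => <-.
Qed.

Lemma has_csum_le (I : choiceType) (f g : I -> R[i]) s t :
  csummable f -> csummable g ->
  (forall i, f i <= g i) -> has_csum f s -> has_csum g t -> s <= t.
Proof.
move=> fS gS fg fs gt.
have h : has_csum (fun i => g i + (-1) * f i) (t + (-1) * s).
  by apply: has_csumD gt (has_csumZ _ fs).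
have hS : csummable (fun i => g i + (-1) * f i).
  by apply: csummableD gS (csummableZ _ fS).
have hE i : g i + (-1) * f i = (nrm (g i + (-1) * f i))%:C%C.
  by rewrite -nrmE ger0_norm// mulN1r subr_ge0.
have [||r [r0 hr]] := @has_csum_ge0 _ (fun i => nrm (g i + (-1) * f i)).
- by move=> i; exact: nrm_ge0.
- by rewrite (_ : (fun i => _) = fun i => g i + (-1) * f i)//; apply/funext => i.
have : has_csum (fun i => g i + (-1) * f i) r%:C%C.
  by apply: has_csum_ext hr => i; rewrite -hE.
by move=> /(has_csum_uniq h); rewrite mulN1r -subr_ge0 => ->; rewrite ler0c.
Qed.
End Sums.

Definition two_sided_ideal (A : pzRingType) (J : set A) : Prop :=
  [/\ J 0, forall x y, J x -> J y -> J (x - y),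
      forall a x, J x -> J (a * x) & forall a x, J x -> J (x * a)].

HB.mixin Record isTwoSidedIdeal (A : pzRingType) (J : {pred A}) := {
  tsidealP : two_sided_ideal [set` J] }.

#[short(type="tsideal")]
HB.structure Definition TwoSidedIdeal (A : pzRingType) :=
  {J of isTwoSidedIdeal A J & GRing.ZmodClosed A J}.

(* The library makes quotients by ideals rings only in the commutative case;
   the quotient type and its additive structure are the library's. *)
Definition quot_ring (A : pzRingType) (J : tsideal A) : Type := Quotient.quot J.

HB.instance Definition _ (A : pzRingType) (J : tsideal A) :=
  EqQuotient.copy (quot_ring J) (Quotient.quot J).
HB.instance Definition _ (A : pzRingType) (J : tsideal A) :=
  GRing.Zmodule.copy (quot_ring J) (Quotient.quot J).

Section QuotientRing.
Variables (A : pzRingType) (J : tsideal A).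
Local Notation Q := (quot_ring J).
Local Open Scope quotient_scope.

Definition quot_one : Q := \pi_Q 1.
Definition quot_mul (p q : Q) : Q := \pi_Q (repr p * repr q).

Lemma quot_mulE (a b : A) : quot_mul (\pi_Q a) (\pi_Q b) = \pi_Q (a * b).
Proof.
have [_ JB Jl Jr] := @tsidealP _ J.
apply/eqP; rewrite -Quotient.idealrBE.
set a' := repr _; set b' := repr _.
have aa : a' - a \in J by rewrite Quotient.idealrBE reprK.
have bb : b' - b \in J by rewrite Quotient.idealrBE reprK.
have -> : a' * b' - a * b = a' * (b' - b) + (a' - a) * b.
  by rewrite mulrBr mulrBl addrA subrK.
by apply: rpredD; [exact: (Jl a' _ bb)|exact: (Jr b _ aa)].
Qed.

Let quotW (P : Q -> Prop) : (forall a : A, P (\pi_Q a)) -> forall p, P p.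
Proof. by move=> h p; rewrite -[p]reprK. Qed.

Let quotD (a b : A) : \pi_Q a + \pi_Q b = \pi_Q (a + b).
Proof. by rewrite !piE. Qed.

Fact quot_mulA : associative quot_mul.
Proof.
by elim/quotW=> a; elim/quotW=> b; elim/quotW=> c; rewrite !quot_mulE mulrA.
Qed.

Fact quot_mul1r : left_id quot_one quot_mul.
Proof. by elim/quotW=> a; rewrite quot_mulE mul1r. Qed.

Fact quot_mulr1 : right_id quot_one quot_mul.
Proof. by elim/quotW=> a; rewrite quot_mulE mulr1. Qed.

Fact quot_mulDl : left_distributive quot_mul +%R.
Proof.
elim/quotW=> a; elim/quotW=> b; elim/quotW=> c.
by rewrite quotD !quot_mulE quotD mulrDl.
Qed.

Fact quot_mulDr : right_distributive quot_mul +%R.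
Proof.
elim/quotW=> a; elim/quotW=> b; elim/quotW=> c.
by rewrite quotD !quot_mulE quotD mulrDr.
Qed.

HB.instance Definition _ := GRing.Zmodule_isPzRing.Build Q
  quot_mulA quot_mul1r quot_mulr1 quot_mulDl quot_mulDr.
End QuotientRing.

Definition l1_pred (R : realType) (G : groupType) : {pred G -> R[i]^o} :=
  fun f => csummable f.

Arguments l1_pred : clear implicits.

Record l1 (R : realType) (G : groupType) :=
  L1 { l1_fun :> G -> R[i]^o ; _ : l1_fun \in l1_pred R G }.

HB.instance Definition _ (R : realType) (G : groupType) :=
  [isSub for @l1_fun R G].
HB.instance Definition _ (R : realType) (G : groupType) :=
  [Choice of l1 R G by <:].

Fact l1_submod_closed (R : realType) (G : groupType) : submod_closed (l1_pred R G).
Proof.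
split=> [|c f g fS gS]; first exact: (@csummable1 _ _ (fun=> 0) 1%g).
exact: csummableD (csummableZ c fS) gS.
Qed.

HB.instance Definition _ (R : realType) (G : groupType) :=
  GRing.isSubmodClosed.Build _ _ (l1_pred R G) (l1_submod_closed R G).
HB.instance Definition _ (R : realType) (G : groupType) :=
  [SubChoice_isSubLmodule of l1 R G by <:].

Section L1Algebra.
Variables (R : realType) (G : groupType).
Local Notation A := (l1 R G).
Implicit Types f g h : A.

Lemma l1_summable f : csummable f. Proof. by case: f. Qed.

Lemma l1_ext f g : f =1 g -> f = g.
Proof. by move=> fg; apply/val_inj/funext. Qed.

Definition l1_mul_fun f g : G -> R[i]^o :=
  fun x => csum (fun u => f u * g (u^-1 * x)%g).

Lemma l1_pair_summable f g :
  csummable (fun p : G * G => f p.1 * g (p.1^-1 * p.2)%g).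
Proof.
apply: (@csummableM _ _ _ f g (fun u x : G => (u^-1 * x)%g)).
- by move=> u; exact: mulgI.
- exact: l1_summable.
- exact: l1_summable.
Qed.

Lemma csummable_row (I J : choiceType) (F : I -> J -> R[i]) i :
  csummable (fun p => F p.1 p.2) -> csummable (F i).
Proof.
move=> /csummableP[M HM]; apply/csummableP; exists M => B.
apply: le_trans (HM [fset (i, j) | j in B]%fset).
by rewrite (@sum_bij _ _ _ (fun j => (i, j)) _ (fun p => nrm (F p.1 p.2)))// => j k [].
Qed.

Lemma csummable_swap (I J : choiceType) (F : I -> J -> R[i]) :
  csummable (fun p => F p.1 p.2) -> csummable (fun p => F p.2 p.1).
Proof.
move=> /csummableP[M HM]; apply/csummableP; exists M => B.
apply: le_trans (HM [fset (p.2, p.1) | p in B]%fset).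
rewrite (@sum_bij _ _ _ (fun p => (p.2, p.1)) _ (fun p => nrm (F p.1 p.2)))//.
by move=> [? ?] [? ?] [-> ->].
Qed.

Lemma l1_mul_has_csum f g x :
  has_csum (fun u => f u * g (u^-1 * x)%g) (l1_mul_fun f g x).
Proof.
apply: csummable_has_csum.
exact: (csummable_row (F := fun x u => f u * g (u^-1 * x)%g) x
  (csummable_swap (F := fun u x => f u * g (u^-1 * x)%g) (l1_pair_summable f g))).
Qed.

Fact l1_mul_subproof f g : l1_mul_fun f g \in l1_pred R G.
Proof.
exact: (csummable_rows
  (csummable_swap (F := fun u x => f u * g (u^-1 * x)%g) (l1_pair_summable f g))
  (l1_mul_has_csum f g)).
Qed.

Definition l1_mul f g : A := L1 (l1_mul_subproof f g).

Definition l1_one_fun : G -> R[i]^o := fun x => (x == 1%g)%:R.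

Fact l1_one_subproof : l1_one_fun \in l1_pred R G.
Proof. by apply: (@csummable1 _ _ _ 1%g) => x /negbTE xn1; rewrite /l1_one_fun xn1. Qed.

Definition l1_one : A := L1 l1_one_subproof.

Lemma l1_mulE f g x s :
  has_csum (fun u => f u * g (u^-1 * x)%g) s -> l1_mul f g x = s.
Proof. exact: csumE. Qed.

Fact l1_mulA : associative l1_mul.
Proof.
move=> f g h; apply: l1_ext => x.
pose T (u v : G) : R[i] := f u * g (u^-1 * v)%g * h (v^-1 * x)%g.
have TS : csummable (fun p => T p.1 p.2).
  have /csummableP[M HM] := l1_summable h.
  have hM y : nrm (h y) <= M.
    by have := HM [fset y]%fset; rewrite big_seq_fset1.
  apply: (csummable_le _ (csummableZ (M%:C%C) (l1_pair_summable f g))) => -[u v] /=.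
  rewrite /T !nrmM [leLHS]mulrC ler_wpM2r ?mulr_ge0 ?nrm_ge0// nrm_real//.
  exact: le_trans (nrm_ge0 _) (hM 1%g).
have row u : has_csum (T u) (f u * l1_mul g h (u^-1 * x)%g).
  rewrite /T; apply: (has_csum_ext (f := fun v =>
    f u * (g (u^-1 * v)%g * h (v^-1 * x)%g))) => [v|]; first by rewrite mulrA.
  apply: has_csumZ.
  apply: (has_csum_bij (h := fun v => (u * v)%g) (k := fun v => (u^-1 * v)%g)).
  - exact: mulKg.
  - exact: mulVKg.
  apply: has_csum_ext (l1_mul_has_csum g h (u^-1 * x)%g) => w.
  by rewrite mulKg invgM mulgA.
have col v : has_csum (T^~ v) (l1_mul f g v * h (v^-1 * x)%g).
  rewrite mulrC; apply: has_csum_ext (has_csumZ _ (l1_mul_has_csum f g v)) => u.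
  by rewrite mulrC.
have [s [Hr Hc]] := has_csum_fubini2 TS row col.
by rewrite (l1_mulE Hr) (l1_mulE Hc).
Qed.

Fact l1_mul1r : left_id l1_one l1_mul.
Proof.
move=> f; apply: l1_ext => x; apply: l1_mulE.
rewrite (_ : f x = l1_one 1%g * f (1^-1 * x)%g); last first.
  by rewrite /= /l1_one_fun eqxx mul1r invg1 mul1g.
apply: (@has_csum1 _ _ (fun u => l1_one u * f (u^-1 * x)%g)) => u /negbTE un1.
by rewrite /= /l1_one_fun un1 mul0r.
Qed.

Fact l1_mulr1 : right_id l1_one l1_mul.
Proof.
move=> f; apply: l1_ext => x; apply: l1_mulE.
rewrite (_ : f x = f x * l1_one (x^-1 * x)%g); last first.
  by rewrite /= /l1_one_fun mulVg eqxx mulr1.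
apply: (@has_csum1 _ _ (fun u => f u * l1_one (u^-1 * x)%g)) => u /eqP ux.
rewrite /= /l1_one_fun; case: eqP => [|_]; last by rewrite mulr0.
by move/(congr1 (fun v => (u * v)%g)); rewrite mulVKg mulg1 => /esym.
Qed.

Fact l1_mulDl : left_distributive l1_mul +%R.
Proof.
move=> f g h; apply: l1_ext => x; apply: l1_mulE.
apply: has_csum_ext (has_csumD (l1_mul_has_csum f h x) (l1_mul_has_csum g h x)).
by move=> u; rewrite -mulrDl.
Qed.

Fact l1_mulDr : right_distributive l1_mul +%R.
Proof.
move=> f g h; apply: l1_ext => x; apply: l1_mulE.
apply: has_csum_ext (has_csumD (l1_mul_has_csum f g x) (l1_mul_has_csum f h x)).
by move=> u; rewrite -mulrDr.
Qed.

Fact l1_one_neq0 : l1_one != 0.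
Proof.
apply/eqP => /(congr1 (fun f : A => f 1%g)) /eqP.
by rewrite /= /l1_one_fun eqxx oner_eq0.
Qed.

HB.instance Definition _ := GRing.Zmodule_isNzRing.Build (l1 R G)
  l1_mulA l1_mul1r l1_mulr1 l1_mulDl l1_mulDr l1_one_neq0.

Fact l1_scalerAl (c : R[i]) f g : c *: (f * g) = (c *: f) * g.
Proof.
apply: l1_ext => x; apply/esym/l1_mulE.
apply: has_csum_ext (has_csumZ c (l1_mul_has_csum f g x)) => u.
by rewrite mulrA.
Qed.

Fact l1_scalerAr (c : R[i]) f g : c *: (f * g) = f * (c *: g).
Proof.
apply: l1_ext => x; apply/esym/l1_mulE.
apply: has_csum_ext (has_csumZ c (l1_mul_has_csum f g x)) => u.
by rewrite mulrCA.
Qed.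

HB.instance Definition _ := GRing.Lmodule_isLalgebra.Build R[i] (l1 R G) l1_scalerAl.
HB.instance Definition _ := GRing.Lalgebra_isAlgebra.Build R[i] (l1 R G) l1_scalerAr.

Definition l1_unit : pred A := fun f => `[< exists g, g * f = 1 /\ f * g = 1 >].

Definition l1_inv f : A :=
  if pselect (exists g, g * f = 1 /\ f * g = 1) is left ex then projT1 (cid ex) else f.

Fact l1_mulVr : {in l1_unit, left_inverse 1 l1_inv *%R}.
Proof.
move=> f /asboolP fu; rewrite /l1_inv; case: pselect => // ex.
by case: (cid ex) => g [].
Qed.

Fact l1_mulrV : {in l1_unit, right_inverse 1 l1_inv *%R}.
Proof.
move=> f /asboolP fu; rewrite /l1_inv; case: pselect => // ex.
by case: (cid ex) => g [].
Qed.

Fact l1_unitP f g : g * f = 1 /\ f * g = 1 -> l1_unit f.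
Proof. by move=> h; apply/asboolP; exists g. Qed.

Fact l1_inv_out : {in [predC l1_unit], l1_inv =1 id}.
Proof. by move=> f /asboolPn fu; rewrite /l1_inv; case: pselect. Qed.

HB.instance Definition _ := GRing.NzRing_hasMulInverse.Build (l1 R G)
  l1_mulVr l1_mulrV l1_unitP l1_inv_out.

Definition l1_norm f : R[i] := csum (fun x => `|f x|).

Lemma l1_norm_summable f : csummable (fun x => `|f x|).
Proof.
by apply: csummable_le (l1_summable f) => x; rewrite /nrm normr_id.
Qed.

Lemma l1_norm_has_csum f : has_csum (fun x => `|f x|) (l1_norm f).
Proof. exact: csummable_has_csum (l1_norm_summable f). Qed.

Fact l1_norm_triangle f g : l1_norm (f + g) <= l1_norm f + l1_norm g.
Proof.
apply: (has_csum_le _ _ _ (l1_norm_has_csum (f + g))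
  (has_csumD (l1_norm_has_csum f) (l1_norm_has_csum g))).
- exact: l1_norm_summable.
- exact: csummableD (l1_norm_summable f) (l1_norm_summable g).
- by move=> x; exact: ler_normD.
Qed.

Fact l1_normZ (c : R[i]) f : l1_norm (c *: f) = `|c| * l1_norm f.
Proof.
apply: csumE; apply: has_csum_ext (has_csumZ _ (l1_norm_has_csum f)) => x.
by rewrite -normrM.
Qed.

Fact l1_norm_eq0 f : l1_norm f = 0 -> f = 0.
Proof.
move=> f0; apply: l1_ext => x; apply/eqP; rewrite -normr_le0 -f0.
pose d := fun y => if y == x then `|f x| else 0.
have -> : `|f x| = d x by rewrite /d eqxx.
apply: (has_csum_le (f := d) (g := fun y => `|f y|)).
- by apply: (@csummable1 _ _ _ x) => y /negbTE yx; rewrite /d yx.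
- exact: l1_norm_summable.
- by move=> y; rewrite /d; case: eqP => [->|_] //; exact: normr_ge0.
- by apply: has_csum1 => y /negbTE yx; rewrite /d yx.
- exact: l1_norm_has_csum.
Qed.

HB.instance Definition _ := Lmodule_isNormed.Build R[i] (l1 R G)
  l1_norm_triangle l1_normZ l1_norm_eq0.

End L1Algebra.

Definition unitriangular (M : 'M[int]_3) : bool :=
  [forall i : 'I_3, forall j : 'I_3, (j <= i)%N ==> (M i j == (i == j)%:R)].

Record heisenberg := Heisenberg {
  heis_mx :> 'M[int]_3 ; heis_mxP : unitriangular heis_mx }.

HB.instance Definition _ := [isSub for heis_mx].
HB.instance Definition _ := [Countable of heisenberg by <:].

Section HeisenbergGroup.
Implicit Types A B : 'M[int]_3.

Lemma unitriangularP A :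
  reflect (forall i j : 'I_3, (j <= i)%N -> A i j = (i == j)%:R) (unitriangular A).
Proof.
apply: (iffP forallP) => [h i j ij|h i]; last first.
  by apply/forallP => j; apply/implyP => /h ->.
by have /forallP/(_ j)/implyP/(_ ij)/eqP := h i.
Qed.

Fact unitriangular1 : unitriangular 1%:M.
Proof. by apply/unitriangularP => i j _; rewrite mxE. Qed.

Fact unitriangularM A B : unitriangular A -> unitriangular B -> unitriangular (A *m B).
Proof.
move=> /unitriangularP hA /unitriangularP hB; apply/unitriangularP => i j ij.
rewrite mxE (bigD1 i)//= hA// eqxx mul1r hB// big1 ?addr0// => k ki.
have [ltki|leik] := ltnP k i; first by rewrite hA 1?ltnW// eq_sym (negbTE ki) mul0r.
rewrite hB; last exact: leq_trans ij leik.
case: eqP => [kj|_]; last by rewrite mulr0.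
by case/eqP: ki; apply/val_inj/eqP; rewrite /= eqn_leq leik andbT kj.
Qed.


Let upper_from p A := forall i j : 'I_3, (j < i + p)%N -> A i j = 0.

Let upper_fromM p q A B :
  upper_from p A -> upper_from q B -> upper_from (p + q) (A *m B).
Proof.
move=> hA hB i j ij; rewrite mxE big1// => k _.
have [ki|ik] := ltnP k (i + p); first by rewrite hA// mul0r.
by rewrite hB ?mulr0// (leq_trans ij)// addnA leq_add2r.
Qed.

Let unitriangular_from1 A : unitriangular A <-> upper_from 1 (A - 1%:M).
Proof.
split=> [/unitriangularP hA i j|hA]; first rewrite addn1 ltnS => ij.
  by rewrite !mxE hA// subrr.
apply/unitriangularP => i j ij; have := hA i j.
by rewrite addn1 ltnS => /(_ ij); rewrite !mxE => /eqP; rewrite subr_eq0 => /eqP.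
Qed.

Lemma unitriangular_inv A : unitriangular A ->
  A \in unitmx /\ unitriangular (invmx A).
Proof.
move=> /unitriangular_from1 hN.
have [N AE {}hN] : exists2 N, A = 1%:M + N & upper_from 1 N.
  by exists (A - 1%:M); rewrite // addrC subrK.
have N2 := upper_fromM hN hN; have N3 := upper_fromM N2 hN.
have {}N3 : N *m (N *m N) = 0.
  apply/matrixP => i j; rewrite mulmxA N3 ?mxE// (leq_trans (ltn_ord j))//.
  by rewrite -[leqLHS]add0n leq_add2r.
have AB : A *m (1%:M - N + N *m N) = 1%:M.
  rewrite AE mulmxDl mul1mx mulmxDr mulmxBr mulmx1 N3 addr0.
  by rewrite -addrA [N *m N + _]addrC subrK subrK.
have [Au _] := mulmx1_unit AB; split=> //.
have -> : invmx A = 1%:M - N + N *m N by rewrite -[LHS]mulmx1 -{1}AB mulKmx.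
apply/unitriangular_from1 => i j ij.
have -> : 1%:M - N + N *m N - 1%:M = N *m N - N.
  by rewrite addrAC [1%:M - N]addrC addrK addrC.
by rewrite !mxE hN// subr0 -[RHS](N2 i j) ?mxE// (leq_trans ij)// leq_add2l.
Qed.

End HeisenbergGroup.

Definition heis_one : heisenberg := Heisenberg unitriangular1.
Definition heis_mul (g h : heisenberg) : heisenberg :=
  Heisenberg (unitriangularM (heis_mxP g) (heis_mxP h)).
Definition heis_inv (g : heisenberg) : heisenberg :=
  Heisenberg (unitriangular_inv (heis_mxP g)).2.

Fact heis_mulA : associative heis_mul.
Proof. by move=> g h k; apply/val_inj/mulmxA. Qed.
Fact heis_mul1g : left_id heis_one heis_mul.
Proof. by move=> g; apply/val_inj/mul1mx. Qed.
Fact heis_mulg1 : right_id heis_one heis_mul.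
Proof. by move=> g; apply/val_inj/mulmx1. Qed.
Fact heis_mulVg : left_inverse heis_one heis_inv heis_mul.
Proof.
by move=> g; apply/val_inj/mulVmx; case: (unitriangular_inv (heis_mxP g)).
Qed.
Fact heis_mulgV : right_inverse heis_one heis_inv heis_mul.
Proof.
by move=> g; apply/val_inj/mulmxV; case: (unitriangular_inv (heis_mxP g)).
Qed.

HB.instance Definition _ :=
  isGroup.Build heisenberg heis_mulA heis_mul1g heis_mulg1 heis_mulVg heis_mulgV.

Fact unitriangular_delta (i j : 'I_3) :
  (i < j)%N -> unitriangular (1%:M + delta_mx i j).
Proof.
move=> ij; apply/unitriangularP => k l lk; rewrite !mxE.
case: andP => [[/eqP ki /eqP lj]|_]; last by rewrite addr0.
by move: lk; rewrite ki lj leqNgt ij.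
Qed.

(* Ones in position (1,2), resp. (2,3), counted from 1. *)
Definition hx : heisenberg :=
  Heisenberg (@unitriangular_delta (inord 0) (inord 1) ltac:(by rewrite !inordK)).
Definition hy : heisenberg :=
  Heisenberg (@unitriangular_delta (inord 1) (inord 2) ltac:(by rewrite !inordK)).
Definition hz : heisenberg := (hx * hy * hx^-1 * hy^-1)%g.

Definition zpowg (G : groupType) (g : G) (n : int) : G :=
  match n with Posz m => (g ^+ m)%g | Negz m => (g ^- m.+1)%g end.

Section HeisenbergCoordinates.
Implicit Types g h : heisenberg.
Let i0 : 'I_3 := inord 0.
Let i1 : 'I_3 := inord 1.
Let i2 : 'I_3 := inord 2.

Let ordE (P : 'I_3 -> Prop) : P i0 -> P i1 -> P i2 -> forall i, P i.
Proof.
move=> p0 p1 p2 [[|[|[|//]]] h].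
- by rewrite (_ : Ordinal h = i0)//; apply/val_inj; rewrite /= inordK.
- by rewrite (_ : Ordinal h = i1)//; apply/val_inj; rewrite /= inordK.
- by rewrite (_ : Ordinal h = i2)//; apply/val_inj; rewrite /= inordK.
Qed.

Let sumE (F : 'I_3 -> int) : \sum_i F i = F i0 + F i1 + F i2.
Proof.
rewrite !big_ord_recl big_ord0 addr0 addrA.
by do 2?congr (_ + _); congr F; apply/val_inj; rewrite /= inordK.
Qed.

Let low g (i j : 'I_3) : (j <= i)%N -> g i j = (i == j)%:R.
Proof. by move/unitriangularP: (heis_mxP g); exact. Qed.

Let v0 : val i0 = 0%N. Proof. exact: inordK. Qed.
Let v1 : val i1 = 1%N. Proof. exact: inordK. Qed.
Let v2 : val i2 = 2%N. Proof. exact: inordK. Qed.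

Let lowE g : (g i0 i0 = 1) * (g i1 i1 = 1) * (g i2 i2 = 1) * (g i1 i0 = 0)
  * (g i2 i0 = 0) * (g i2 i1 = 0).
Proof. by do !split; rewrite low -?val_eqE /= ?v0 ?v1 ?v2. Qed.

Lemma heis_ext g h : g i0 i1 = h i0 i1 -> g i1 i2 = h i1 i2 -> g i0 i2 = h i0 i2 ->
  g = h.
Proof.
move=> e01 e12 e02; apply/val_inj/matrixP.
by elim/ordE; elim/ordE; rewrite /= ?lowE.
Qed.

Lemma heis_mul01 g h : (g * h)%g i0 i1 = g i0 i1 + h i0 i1.
Proof. by rewrite [LHS]mxE sumE !lowE mul1r mulr1 mulr0 addr0 addrC. Qed.

Lemma heis_mul12 g h : (g * h)%g i1 i2 = g i1 i2 + h i1 i2.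
Proof. by rewrite [LHS]mxE sumE !lowE mul1r mulr1 mul0r add0r addrC. Qed.

Lemma heis_mul02 g h :
  (g * h)%g i0 i2 = g i0 i2 + h i0 i2 + g i0 i1 * h i1 i2.
Proof. by rewrite [LHS]mxE sumE !lowE mul1r mulr1 addrC addrA. Qed.

Let one_e : ((1 : heisenberg)%g i0 i1 = 0) * ((1 : heisenberg)%g i1 i2 = 0)
  * ((1 : heisenberg)%g i0 i2 = 0).
Proof. by do !split; rewrite mxE -val_eqE /= ?v0 ?v1 ?v2. Qed.

Lemma heis_inv01 g : (g^-1)%g i0 i1 = - g i0 i1.
Proof. by apply/eqP; rewrite -addr_eq0 -heis_mul01 mulVg one_e. Qed.

Lemma heis_inv12 g : (g^-1)%g i1 i2 = - g i1 i2.
Proof. by apply/eqP; rewrite -addr_eq0 -heis_mul12 mulVg one_e. Qed.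

Lemma heis_inv02 g : (g^-1)%g i0 i2 = - g i0 i2 + g i0 i1 * g i1 i2.
Proof.
have := heis_mul02 (g^-1)%g g; rewrite mulVg one_e heis_inv01 => /esym h.
by lra.
Qed.

Let zpow_hom (phi : heisenberg -> int) g n :
  (forall g h, phi (g * h)%g = phi g + phi h) -> phi (zpowg g n) = phi g * n.
Proof.
move=> hM; have h1 : phi 1%g = 0.
  by have := hM 1%g 1%g; rewrite mul1g; lra.
have hX m : phi (g ^+ m)%g = phi g * m%:Z.
  elim: m => [|m IH]; first by rewrite expg0 mulr0.
  by rewrite expgS hM IH intS mulrDr mulr1.
case: n => m; first exact: hX.
by have := hM (g ^- m.+1)%g (g ^+ m.+1)%g; rewrite mulVg h1 hX NegzE /=; lra.
Qed.

Lemma heis_zpow01 g n : zpowg g n i0 i1 = g i0 i1 * n.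
Proof. by apply: (@zpow_hom (fun g => g i0 i1)) => *; exact: heis_mul01. Qed.

Lemma heis_zpow12 g n : zpowg g n i1 i2 = g i1 i2 * n.
Proof. by apply: (@zpow_hom (fun g => g i1 i2)) => *; exact: heis_mul12. Qed.

Lemma heis_zpow02 g n :
  g i0 i1 * g i1 i2 = 0 -> zpowg g n i0 i2 = g i0 i2 * n.
Proof.
move=> g0; have hX m : (g ^+ m)%g i0 i2 = g i0 i2 * m%:Z.
  elim: m => [|m IH]; first by rewrite expg0 one_e mulr0.
  rewrite expgS heis_mul02 IH -[(g ^+ m)%g]/(zpowg g m) heis_zpow12.
  by rewrite mulrA g0 mul0r addr0 intS mulrDr mulr1.
case: n => m; first exact: hX.
rewrite /= heis_inv02 hX -[(g ^+ m.+1)%g]/(zpowg g m.+1) heis_zpow01 heis_zpow12.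
by rewrite mulrACA g0 mul0r addr0 NegzE mulrN.
Qed.

Lemma hxE : (hx i0 i1 = 1) * (hx i1 i2 = 0) * (hx i0 i2 = 0).
Proof. by do !split; rewrite !mxE -!val_eqE /= ?v0 ?v1 ?v2 ?inordK. Qed.

Lemma hyE : (hy i0 i1 = 0) * (hy i1 i2 = 1) * (hy i0 i2 = 0).
Proof. by do !split; rewrite !mxE -!val_eqE /= ?v0 ?v1 ?v2 ?inordK. Qed.

Lemma hzE : (hz i0 i1 = 0) * (hz i1 i2 = 0) * (hz i0 i2 = 1).
Proof.
rewrite /hz; do !split; rewrite !(heis_mul01, heis_mul12, heis_mul02,
  heis_inv01, heis_inv12, heis_inv02) !hxE !hyE; lra.
Qed.

Lemma heis_central g :
  (forall h, commute g h) <-> exists n : int, g = zpowg hz n.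
Proof.
split=> [gc|[n ->] h].
  exists (g i0 i2); have := gc hx; have := gc hy.
  move=> /(congr1 (fun k : heisenberg => k i0 i2)) ey.
  move=> /(congr1 (fun k : heisenberg => k i0 i2)) ex.
  move: ex ey; rewrite !heis_mul02 !hxE !hyE => ex ey.
  by apply: heis_ext; rewrite ?heis_zpow01 ?heis_zpow12 ?heis_zpow02 ?hzE; lra.
apply: heis_ext;
  rewrite ?heis_mul01 ?heis_mul12 ?heis_mul02 ?heis_zpow01 ?heis_zpow12 ?heis_zpow02 ?hzE//; lra.
Qed.

Lemma heis_normal_form g : exists! klm : int * int * int,
  g = (zpowg hx klm.1.1 * zpowg hy klm.1.2 * zpowg hz klm.2)%g.
Proof.
exists (g i0 i1, g i1 i2, g i0 i2 - g i0 i1 * g i1 i2); split=> /=.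
  by apply: heis_ext; rewrite ?(hzE, heis_zpow01, heis_zpow12, heis_mul01,
    heis_mul12, heis_mul02) ?heis_zpow02 ?(hxE, hyE, hzE)//; ring.
move=> [[k l] m] /= ->; rewrite !(hzE, heis_zpow01, heis_zpow12, heis_mul01,
  heis_mul12, heis_mul02) !heis_zpow02 ?(hxE, hyE, hzE)//.
by congr (_, _, _); ring.
Qed.

End HeisenbergCoordinates.

Section LocalIdeals.
Variable R : realType.
Local Notation A := (l1 R heisenberg).

(* The maximal ideal m_theta of l^1 of the center, as a subset of l^1 of the
   group: by heis_central, the center is the set of powers of hz. *)
Definition m_ideal (theta : R[i]) : set A :=
  [set h | (forall g : heisenberg, h g != 0 -> forall g', commute g g') /\
           csum (fun n : int => h (zpowg hz n) * theta ^ n) = 0].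

Definition J_set (theta : R[i]) : set A :=
  smallest [set I : set A | closed I /\ two_sided_ideal I]
    (m_ideal theta).

Definition J_ideal (theta : R[i]) : {pred A} := fun f => `[< J_set theta f >].

Lemma J_set_two_sided theta : two_sided_ideal (J_set theta).
Proof.
split.
- by move=> I [[_ [? ? ? ?]] _].
- by move=> f g If Ig I hI; case: (hI) => -[_ [_ h _ _]] _; apply: h; [exact: If|exact: Ig].
- by move=> f g Ig I hI; case: (hI) => -[_ [_ _ h _]] _; apply: h; exact: Ig.
- by move=> f g Ig I hI; case: (hI) => -[_ [_ _ _ h]] _; apply: h; exact: Ig.
Qed.

Lemma J_idealE theta : [set` J_ideal theta] = J_set theta.
Proof. by apply/funext => f; apply/propext; split=> [/asboolP|?]; last apply/asboolP. Qed.

Fact J_ideal_zmod_closed theta : zmod_closed (J_ideal theta).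
Proof.
have [J0 JB _ _] := J_set_two_sided theta.
by split=> [|f g /asboolP ? /asboolP ?]; apply/asboolP => //; exact: JB.
Qed.

HB.instance Definition _ theta :=
  GRing.isZmodClosed.Build _ (J_ideal theta) (J_ideal_zmod_closed theta).

Fact J_ideal_two_sided theta : two_sided_ideal [set` J_ideal theta].
Proof. by rewrite J_idealE; exact: J_set_two_sided. Qed.

HB.instance Definition _ theta :=
  isTwoSidedIdeal.Build _ (J_ideal theta) (J_ideal_two_sided theta).

End LocalIdeals.

(* Main.v *)
(* Suppose that [a] has no right inverse, and let [M] be a maximal right ideal
   containing it; [M] is closed, by the Neumann series.  As [z] is central it acts
   on A/M by endomorphisms, and it acts as a scalar [theta] of modulus 1:
   otherwise (by maximality, as in Schur's lemma) every 1 - l z with |l| = 1 is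
   invertible modulo [M], with an inverse F_1(l) that is bounded (compactness),
   hence Lipschitz in [l] (resolvent identity).  For F_n(l) = (1 - l z^n)^-1 the identity
   F_2n(l^2) = (F_n(l) + F_n(-l)) / 2 improves the Lipschitz constant at each
   doubling, so F_n(1) - F_n(-1) tends to 0; but
   (1 - z^2n) (F_n(1) - F_n(-1)) = 2 z^n does not.  Therefore [M] contains
   m_theta, then J_theta, and a b_theta - 1 in J_theta contradicts 1 notin M.

   A right inverse is two-sided because the group is residually finite: in each
   permutation representation on a finite quotient a b = 1 implies b a = 1, and
   these representations separate the points of l^1. *)
Require Import Defs.
From HB Require Import structures.
From mathcomp Require Import all_boot all_order all_algebra finmap complex ring lra zify.
From mathcomp Require Import generic_quotient ring_quotient.
From mathcomp Require Import all_classical all_reals all_analysis.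

Set Implicit Arguments.
Unset Strict Implicit.
Unset Printing Implicit Defensive.
Import Order.TTheory GRing.Theory Num.Theory.
Import numFieldNormedType.Exports.
Local Open Scope classical_set_scope.
Local Open Scope ring_scope.
Local Open Scope quotient_scope.

(** * Estimates and reindexing for unordered sums *)

Section Sums.
Variable R : realType.
Local Open Scope fset_scope.
Local Open Scope ring_scope.

Lemma has_csum_nrm_le (I : choiceType) (f : I -> R[i]) s (M : R) :
  has_csum f s -> (forall A : {fset I}, \sum_(i <- A) nrm (f i) <= M) -> nrm s <= M.
Proof.
move=> fs HM; apply/ler_addgt0Pr => e e0; have [A /(_ A (fsubset_refl _)) HA] := fs e e0.
rewrite -[s](subrK (\sum_(i <- A) f i)) addrC (le_trans (nrmD _ _))// lerD//.
  exact: le_trans (nrm_sum _ _) (HM A).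
by rewrite nrmB ltW.
Qed.

(** One finite set of columns approximates all the rows in [B] with total error at most [e], so the
    bound [M] passes to the row sums without loss; submultiplicativity of the norm rests on this. *)
Lemma sum_nrm_rows_le (I J : choiceType) (F : I -> J -> R[i]) g (M : R) :
  (forall A : {fset I * J}, \sum_(p <- A) nrm (F p.1 p.2) <= M) ->
  (forall i, has_csum (F i) (g i)) ->
  forall B : {fset I}, \sum_(i <- B) nrm (g i) <= M.
Proof.
move=> HM Fg B; apply/ler_addgt0Pr => e e0.
pose d := e / (size B).+1%:R.
have d0 : 0 < d by rewrite divr_gt0.
have [C HC] := has_csum_common B d0 Fg.
apply: (@le_trans _ _ (\sum_(i <- B) (\sum_(j <- C) nrm (F i j) + d))).
  rewrite big_seq [leRHS]big_seq ler_sum// => i iB.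
  rewrite -[X in nrm X](subrK (\sum_(j <- C) F i j)) addrC.
  by rewrite (le_trans (nrmD _ _))// lerD ?nrm_sum// nrmB ltW// HC.
rewrite big_split lerD//; first by rewrite -(sum_fsetM _ _ (fun i j => nrm (F i j))) HM.
rewrite big_const_seq count_predT iter_addr_0 -[leLHS]mulr_natr /d.
by rewrite mulrAC ler_pdivrMr// ler_pM2l// ler_nat.
Qed.

Lemma sum_nrmM_le (I J : choiceType) (f : I -> R[i]) (g : J -> R[i])
    (k : I -> J -> J) (M N : R) : (forall i, injective (k i)) ->
  (forall A : {fset I}, \sum_(i <- A) nrm (f i) <= M) ->
  (forall A : {fset J}, \sum_(i <- A) nrm (g i) <= N) ->
  forall A : {fset I * J}, \sum_(p <- A) nrm (f p.1 * g (k p.1 p.2)) <= M * N.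
Proof.
move=> ki HM HN A.
have N0 : 0 <= N by rewrite (le_trans _ (HN fset0))// big_seq_fset0.
have /(@ler_sum_fset R) H : A `<=` [fset p.1 | p in A] `*` [fset p.2 | p in A].
  apply/fsubsetP => p pA; rewrite in_fsetM.
  by apply/andP; split; apply/imfsetP; exists p.
apply: le_trans (H _ _) _ => [p|]; first exact: nrm_ge0.
rewrite (sum_fsetM _ _ (fun i j => nrm (f i * g (k i j)))).
apply: (@le_trans _ _ (\sum_(i <- [fset p.1 | p in A]) nrm (f i) * N)); last first.
  by rewrite -mulr_suml ler_wpM2r.
rewrite ler_sum// => i _.
under eq_bigr do rewrite nrmM.
rewrite -mulr_sumr ler_wpM2l ?nrm_ge0//.
by rewrite -(sum_bij _ (fun j => nrm (g j)) (ki i)).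
Qed.

(** Reindexing along an injection whose image carries the support of [f]. It serves for the shift of
    the natural numbers and for the center inside the group. *)
Lemma has_csum_inj (I J : choiceType) (h : I -> J) (k : J -> I)
    (f : J -> R[i]) s : cancel h k -> (forall j, h (k j) != j -> f j = 0) ->
  has_csum (fun i => f (h i)) s -> has_csum f s.
Proof.
move=> hk f0 fs e e0; have [A HA] := fs e e0.
exists [fset h i | i in A] => B AB.
pose C := [fset k j | j in B & h (k j) == j].
have -> : \sum_(j <- B) f j = \sum_(i <- C) f (h i).
  rewrite -(sum_bij _ f (can_inj hk)) (bigID (fun j => h (k j) == j))/=.
  rewrite [X in _ + X]big1 ?addr0; last by move=> j /f0.
  rewrite -big_filter; apply: perm_big; apply: uniq_perm; rewrite ?filter_uniq//.
  move=> j; rewrite mem_filter; apply/andP/imfsetP => /=.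
    move=> [/eqP hj jB]; exists (k j); rewrite ?hj//.
    by apply/imfsetP; exists j; rewrite // !inE jB hj eqxx.
  move=> [i /imfsetP[j' /= ]]; rewrite !inE => /andP[jB /eqP hj] -> ->.
  by rewrite hj hj eqxx.
apply: HA; apply/fsubsetP => i iA; apply/imfsetP; exists (h i) => /=; last by rewrite hk.
rewrite !inE hk eqxx andbT.
by move/fsubsetP: AB; apply; apply/imfsetP; exists i.
Qed.

Lemma has_csum_nat_recl (g : nat -> R[i]) s :
  has_csum (fun n => g n.+1) s -> has_csum g (g 0%N + s).
Proof.
move=> gs; pose g0 n := if n == 0%N then g 0%N else 0.
pose g1 n := if n == 0%N then 0 else g n.
apply: (has_csum_ext (f := fun n => g0 n + g1 n)).
  by case=> [|n]; rewrite /g0 /g1 /= ?addr0 ?add0r.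
apply: has_csumD; first by apply: (@has_csum1 _ _ g0 0%N) => i /negbTE i0; rewrite /g0 i0.
(* As [predn 0] is 0, the point 0 is the only one that [S] after [predn] moves, and [g1] vanishes
   there. *)
apply: (@has_csum_inj _ _ S predn g1) => //; case=> [//|n].
by rewrite eqxx.
Qed.

End Sums.

(** * The norm of l^1 and geometric sums *)

Section L1Norm.
Variables (R : realType) (G : groupType).
Local Notation A := (l1 R G).
Implicit Types (f g : A) (x y : G).
Local Open Scope fset_scope.
Local Open Scope ring_scope.

(** The norm with values in [R]; the norm of the normed module lies in [R[i]]. *)
Definition l1n f : R := complex.Re `|f|.

Lemma l1n_has_csum f : has_csum (fun x => (nrm (f x))%:C%C) (l1n f)%:C%C.
Proof.
have [|s [_ hs]] := @has_csum_ge0 R G (fun x => nrm (f x)) (fun x => nrm_ge0 (f x)).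
  by apply: csummable_le (l1_summable f) => x; rewrite nrm_real ?nrm_ge0.
suff -> : l1n f = s by [].
suff : `|f| = s%:C%C by rewrite /l1n => ->.
by apply: csumE; apply: has_csum_ext hs => x; rewrite nrmE.
Qed.

Lemma l1nE f : `|f| = (l1n f)%:C%C.
Proof.
apply: (has_csum_uniq (l1_norm_has_csum f)).
by apply: has_csum_ext (l1n_has_csum f) => x; rewrite nrmE.
Qed.

Lemma l1n_ge0 f : 0 <= l1n f.
Proof. by rewrite -ler0c -l1nE. Qed.

Lemma l1nD f g : l1n (f + g) <= l1n f + l1n g.
Proof. by rewrite -lecR rmorphD /= -!l1nE ler_normD. Qed.

Lemma l1nN f : l1n (- f) = l1n f.
Proof. by rewrite /l1n normrN. Qed.

Lemma l1nZ c f : l1n (c *: f) = nrm c * l1n f.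
Proof. by apply: complexI; rewrite rmorphM /= -!l1nE -nrmE normrZ. Qed.

Lemma l1n_le f M : (forall B : {fset G}, \sum_(x <- B) nrm (f x) <= M) -> l1n f <= M.
Proof.
move=> HM; rewrite -(nrm_real (l1n_ge0 f)).
apply: (has_csum_nrm_le (l1n_has_csum f)) => B.
by rewrite (eq_bigr (fun x => nrm (f x))) ?HM// => x _; rewrite nrm_real ?nrm_ge0.
Qed.

Lemma sum_nrm_le f (B : {fset G}) : \sum_(x <- B) nrm (f x) <= l1n f.
Proof.
apply/ler_addgt0Pr => e e0; have [C HC] := l1n_has_csum f e0.
have := HC _ (fsubsetUl C B); rewrite -rmorph_sum -rmorphB /= => /ltW.
move/(le_trans (nrm_Re _)) => /=; rewrite ler_distl => /andP[_].
by apply: le_trans; apply: ler_sum_fset (fsubsetUr C B) => x; exact: nrm_ge0.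
Qed.

Lemma nrm_le_l1n f x : nrm (f x) <= l1n f.
Proof. by have := sum_nrm_le f [fset x]; rewrite big_seq_fset1. Qed.

Lemma l1nM f g : l1n (f * g) <= l1n f * l1n g.
Proof.
apply: l1n_le.
apply: (sum_nrm_rows_le (F := fun x u => f u * g (u^-1 * x)%g)) => [B|]; last first.
  exact: l1_mul_has_csum.
have sw_inj : injective (fun p : G * G => (p.2, p.1)) by move=> [? ?] [? ?] [-> ->].
have := sum_nrmM_le (k := fun u x : G => (u^-1 * x)%g) (fun u => @mulgI _ _)
  (sum_nrm_le f) (sum_nrm_le g) [fset (p.2, p.1) | p in B].
by rewrite (sum_bij _ (fun p => nrm (f p.1 * g (p.1^-1 * p.2)%g)) sw_inj).
Qed.

Lemma l1n1_le : l1n 1 <= 1.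
Proof.
apply: l1n_le => B; have [B1|B1] := boolP (1%g \in B).
  rewrite (big_rem 1%g)//= big_seq big1 ?addr0 => [|x].
    by rewrite /l1_one_fun eqxx (nrm_real (R := R) (r := 1)).
  rewrite mem_rem_uniq ?fset_uniq// => /andP[/= x1 _].
  by rewrite /l1_one_fun (negbTE x1); exact: nrm0.
rewrite big_seq big1// => x xB; rewrite /= /l1_one_fun.
by case: eqP xB B1 => [-> ->//|_ _ _]; exact: nrm0.
Qed.

Lemma l1nX f n : l1n (f ^+ n) <= l1n f ^+ n.
Proof.
elim: n => [|n IH]; first exact: l1n1_le.
rewrite !exprS (le_trans (l1nM _ _))// ler_wpM2l ?l1n_ge0//.
Qed.

Lemma sum_exp_le (q : R) (B : {fset nat}) : 0 <= q < 1 ->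
  \sum_(n <- B) q ^+ n <= (1 - q)^-1.
Proof.
move=> /andP[q0 q1].
have [m Bm] : exists m, {subset B <= iota 0 m}.
  exists (\max_(n <- B) n).+1 => n nB; rewrite mem_iota add0n ltnS /=.
  by rewrite (big_rem n)//= leq_maxl.
apply: (@le_trans _ _ (\sum_(n <- [fset n in iota 0 m]) q ^+ n)).
  apply: ler_sum_fset => [n|]; first exact: exprn_ge0.
  by apply/fsubsetP => n nB; apply/imfsetP; exists n => //=; exact: Bm.
rewrite (perm_big (iota 0 m)) /=; last first.
  apply: uniq_perm; rewrite ?fset_uniq ?iota_uniq// => n.
  by apply/imfsetP/idP => [[? ? ->]|nm] //; exists n.
rewrite -[m]subn0 -/(index_iota 0 m) big_mkord.
rewrite -[leRHS]mul1r ler_pdivlMr ?subr_gt0//.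
have := subrX1 q m; have := exprn_ge0 m q0; lra.
Qed.

End L1Norm.

(** * Neumann series *)

Section Neumann.
Variables (R : realType) (G : groupType).
Local Notation A := (l1 R G).
Implicit Types (f g : A) (x y : G).
Local Open Scope fset_scope.
Local Open Scope ring_scope.

Lemma l1_mul_hasE f g x : has_csum (fun u => f u * g (u^-1 * x)%g) ((f * g) x).
Proof. exact: l1_mul_has_csum. Qed.

(** [w] is the pointwise sum of the powers of [f]. By Fubini, [f * w] is the sum of the powers with
    positive exponent. *)
Lemma neumann f : l1n f < 1 -> exists w, w = 1 + f * w.
Proof.
move=> f1; have q01 : 0 <= l1n f < 1 by rewrite l1n_ge0.
pose F (x : G) n := (f ^+ n) x : R[i].
have FB (B : {fset nat * G}) : \sum_(p <- B) nrm (F p.2 p.1) <= (1 - l1n f)^-1.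
  pose B1 := [fset p.1 | p in B]; pose B2 := [fset p.2 | p in B].
  have /(@ler_sum_fset R) H : B `<=` B1 `*` B2.
    apply/fsubsetP => p pB; rewrite in_fsetM.
    by apply/andP; split; apply/imfsetP; exists p.
  apply: le_trans (H _ _) _ => [p|]; first exact: nrm_ge0.
  rewrite (sum_fsetM B1 B2 (fun n x => nrm (F x n))).
  apply: le_trans (sum_exp_le B1 q01); apply: ler_sum => n _.
  exact: le_trans (sum_nrm_le _ _) (l1nX _ _).
have FS : csummable (fun p : G * nat => F p.1 p.2).
  apply: (csummable_swap (F := fun n x => F x n)).
  by apply/csummableP; exists (1 - l1n f)^-1.
have Fw x : has_csum (F x) (csum (F x)).
  exact: csummable_has_csum (csummable_row x FS).
have wS : (fun x => csum (F x) : R[i]^o) \in l1_pred R G.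
  exact: csummable_rows FS Fw.
exists (L1 wS); apply: l1_ext => x /=.
(* The family is dominated by f(u) |f|^n, a product of two summable families. *)
have TS : csummable (fun p : G * nat => f p.1 * F (p.1^-1 * x)%g p.2).
  apply: (csummable_le (g := fun p : G * nat => f p.1 * (l1n f ^+ p.2)%:C%C)).
    move=> [u n] /=; rewrite !nrmM ler_wpM2l ?nrm_ge0//.
    rewrite nrm_real ?exprn_ge0 ?l1n_ge0//.
    exact: le_trans (nrm_le_l1n _ _) (l1nX _ _).
  apply: (@csummableM _ _ _ (fun u => f u) (fun n => (l1n f ^+ n)%:C%C) (fun _ n => n)).
  - by move=> _ n m.
  - exact: l1_summable.
  - apply/csummableP; exists (1 - l1n f)^-1 => B.
    apply: le_trans (sum_exp_le B q01); apply: ler_sum => n _.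
    by rewrite nrm_real// exprn_ge0// l1n_ge0.
have row u : has_csum (fun n => f u * F (u^-1 * x)%g n) (f u * L1 wS (u^-1 * x)%g).
  exact: has_csumZ (Fw _).
have col n : has_csum (fun u => f u * F (u^-1 * x)%g n) (F x n.+1).
  by rewrite /F exprS; exact: l1_mul_hasE.
have [s [Hr Hc]] := has_csum_fubini2 (F := fun u n => f u * F (u^-1 * x)%g n) TS row col.
rewrite (csumE (has_csum_nat_recl Hc)) {1}/F expr0; congr (_ + _).
by rewrite (has_csum_uniq Hr (l1_mul_hasE _ _ _)).
Qed.

Lemma neumann_rinv f : l1n (1 - f) < 1 -> exists w, f * w = 1.
Proof.
move=> /neumann[w wE]; exists w; rewrite mulrBl mul1r in wE.
by apply: (addIr (w - f * w)); rewrite -wE addrC subrK.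
Qed.

(** The equation gives |w| <= 1 + |w| / 2. *)
Lemma neumann_norm f w : l1n f <= 2^-1 -> w = 1 + f * w -> l1n w <= 2.
Proof.
move=> f2 wE.
have := l1nD 1 (f * w); rewrite -wE; have := l1n1_le R G.
have := l1nM f w; have := l1n_ge0 w.
move=> w0 fw n1 h; have : l1n f * l1n w <= 2^-1 * l1n w by rewrite ler_wpM2r.
lra.
Qed.

End Neumann.

(** * Point masses and central elements *)

Section Delta.
Variables (R : realType) (G : groupType).
Local Notation A := (l1 R G).
Implicit Types (f : A) (g h x y : G).
Local Open Scope fset_scope.
Local Open Scope ring_scope.

Definition l1_delta_fun g : G -> R[i]^o := fun x => (x == g)%:R.

Fact l1_delta_subproof g : l1_delta_fun g \in l1_pred R G.
Proof.
by apply: (@csummable1 _ _ _ g) => x /negbTE xg; rewrite /l1_delta_fun xg.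
Qed.

Definition l1_delta g : A := L1 (l1_delta_subproof g).

Lemma l1_deltaE g x : l1_delta g x = (x == g)%:R.
Proof. by []. Qed.

Lemma mul_delta_l g f x : (l1_delta g * f) x = f (g^-1 * x)%g.
Proof.
apply: l1_mulE; rewrite (_ : f _ = l1_delta g g * f (g^-1 * x)%g); last first.
  by rewrite l1_deltaE eqxx mul1r.
apply: (@has_csum1 _ _ (fun u => l1_delta g u * f (u^-1 * x)%g)) => u /negbTE ug.
by rewrite l1_deltaE ug mul0r.
Qed.

Lemma l1_delta1 : l1_delta 1%g = 1.
Proof. by apply: l1_ext. Qed.

Lemma l1_deltaM g h : l1_delta (g * h)%g = l1_delta g * l1_delta h.
Proof.
apply: l1_ext => x; rewrite mul_delta_l !l1_deltaE; congr (nat_of_bool _)%:R.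
by apply/eqP/eqP => [->|<-]; rewrite ?mulKg// mulVKg.
Qed.

Lemma l1n_deltaM g f : l1n (l1_delta g * f) <= l1n f.
Proof.
apply: l1n_le => B; apply: le_trans (sum_nrm_le f [fset (g^-1 * x)%g | x in B]).
rewrite (sum_bij _ (fun x => nrm (f x)) (@mulgI _ g^-1%g)).
by rewrite ler_sum// => x _; rewrite mul_delta_l.
Qed.

(** Substituting u^-1 x for u exchanges the two factors of the convolution. Where f (u^-1 x) is
    nonzero, u^-1 x is central, so (u^-1 x)^-1 x is again u. *)
Lemma l1_central f (c : A) : (forall g, f g != 0 -> forall h, commute g h) ->
  f * c = c * f.
Proof.
move=> fc; apply: l1_ext => x; apply: l1_mulE.
apply: (has_csum_bij (h := fun u => (u^-1 * x)%g) (k := fun u => (x * u^-1)%g)).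
- by move=> u; rewrite invgM invgK mulVKg.
- by move=> u; rewrite invgM invgK mulgVK.
apply: has_csum_ext (l1_mul_hasE c f x) => u; rewrite mulrC.
have [->|/fc fu] := eqVneq (f (u^-1 * x)%g) 0; first by rewrite !mul0r.
congr (_ * c _); apply: (@mulgI _ (u^-1 * x)%g); rewrite mulVKg.
by rewrite fu mulVKg.
Qed.

End Delta.

(** * Maximal right ideals *)

Section MaximalRightIdeal.
Variable A : nzRingType.
Implicit Types (a x y c : A) (M : set A).

Definition right_ideal M :=
  [/\ M 0, forall x y, M x -> M y -> M (x - y) & forall x c, M x -> M (x * c)].

(** Maximality takes the form in which it is used: every nonzero class generates the right module
    A/M. *)
Definition maximal_right_ideal M :=
  [/\ right_ideal M, ~ M 1 & forall x, ~ M x -> exists c, M (1 - x * c)].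

Lemma maximal_right_ideal_exists a : ~ (exists b, a * b = 1) ->
  exists M, maximal_right_ideal M /\ M a.
Proof.
move=> na.
(* [Zorn_bigcup] also asks for the union of the empty chain, so the empty set
   has to be admissible. *)
pose P M := [/\ ~ M 1, forall x y, M x -> M y -> M (x - y),
  forall x c, M x -> M (x * c) & forall x, M x -> M a].
have [|M [[M1 MB MM Ma] Mmax]] := @Zorn_bigcup A P.
  move=> F FP Ftot; split.
  - by move=> [X /FP[]].
  - move=> x y [X FX Xx] [Y FY Yy].
    have [XY|YX] := Ftot _ _ FX FY.
      by exists Y => //; have [_ YB _ _] := FP _ FY; exact: YB (XY _ Xx) Yy.
    by exists X => //; have [_ XB _ _] := FP _ FX; exact: XB Xx (YX _ Yy).
  - by move=> x c [X FX Xx]; exists X => //; have [_ _ XM _] := FP _ FX; exact: XM.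
  - by move=> x [X FX Xx]; exists X => //; have [_ _ _ h] := FP _ FX; exact: h Xx.
(* Otherwise [M] is empty, and the proper right ideal a A is admissible and strictly larger. *)
have {}Ma : M a.
  apply: contrapT => nMa; have M0 x : ~ M x by move/Ma.
  apply: (Mmax [set a * b | b in [set: A]]).
    by split=> [x /M0//|h]; apply: (M0 (a * 1)); apply: h; exists 1.
  split.
  - by move=> [b _ ab]; apply: na; exists b.
  - by move=> _ _ [b _ <-] [c _ <-]; exists (b - c); rewrite // mulrBr.
  - by move=> _ c [b _ <-]; exists (b * c); rewrite // mulrA.
  - by move=> _ _; exists 1; rewrite ?mulr1.
have M0 : M 0 by rewrite -(subrr a); exact: MB.
exists M; split=> //; split=> // x nMx; apply: contrapT => nc.
have MN y : M y -> M (- y) by move=> My; rewrite -sub0r; exact: MB.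
(* This set is M + x A; if it does not contain 1, it is admissible and strictly larger than [M]. *)
apply: (Mmax [set y | exists c, M (y - x * c)]).
  split=> [y My|/(_ x)]; first by exists 0; rewrite mulr0 subr0.
  by move=> h; apply/nMx/h; exists 1; rewrite mulr1 subrr.
split.
- by case=> c Mc; apply: nc; exists c.
- move=> y z [c My] [d Mz]; exists (c - d).
  rewrite (_ : _ - _ = (y - x * c) - (z - x * d)); first exact: MB.
  by rewrite mulrBr !opprB addrACA [RHS]addrACA [- z + _]addrC.
- move=> y d [c My]; exists (c * d); rewrite mulrA -mulrBl; exact: MM.
- by move=> _ _; exists 0; rewrite mulr0 subr0.
Qed.

End MaximalRightIdeal.

(** * The modulus of a complex number *)

Section Modulus.
Variable R : realType.
Implicit Types x y : R[i].

Lemma sqr_nrm x : nrm x ^+ 2 = complex.Re x ^+ 2 + complex.Im x ^+ 2.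
Proof. by rewrite /nrm normc_def /= sqr_sqrtr// addr_ge0// sqr_ge0. Qed.

Lemma nrm_le_ReIm x : nrm x <= `|complex.Re x| + `|complex.Im x|.
Proof.
rewrite -(@ler_pXn2r _ 2)// ?nnegrE ?nrm_ge0 ?addr_ge0// sqr_nrm.
rewrite -(real_normK (num_real (complex.Re x))) -(real_normK (num_real (complex.Im x))).
have := normr_ge0 (complex.Re x); have := normr_ge0 (complex.Im x); nra.
Qed.

Lemma nrm_parallelogram x y :
  nrm (x + y) ^+ 2 + nrm (x - y) ^+ 2 = 2 * (nrm x ^+ 2 + nrm y ^+ 2).
Proof. by rewrite !sqr_nrm; case: x => a b; case: y => c d /=; ring. Qed.

End Modulus.

(** * Central group elements act as unitary scalars modulo a maximal right ideal *)

Section Spectrum.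
Variables (R : realType) (G : groupType).
Local Notation A := (l1 R G).
Variable M : set A.
Hypothesis Mmax : maximal_right_ideal M.
Implicit Types (x y : A).

Let M0 : M 0. Proof. by case: Mmax => -[]. Qed.
Let M1 : ~ M 1. Proof. by case: Mmax. Qed.
Let MB x y : M x -> M y -> M (x - y). Proof. by case: Mmax => -[_ h _] _ _; exact: h. Qed.
Let MM x c : M x -> M (x * c). Proof. by case: Mmax => -[_ _ h] _ _; exact: h. Qed.
Let MN x : M x -> M (- x). Proof. by move=> ?; rewrite -sub0r; exact: MB. Qed.
Let MD x y : M x -> M y -> M (x + y).
Proof. by move=> ? ?; rewrite -[y]opprK; apply: MB => //; exact: MN. Qed.
Let Mgen x : ~ M x -> exists c, M (1 - x * c). Proof. by move=> ?; case: Mmax => _ _; apply. Qed.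
Let MZ k x : M x -> M (k *: x).
Proof. by move=> Mx; rewrite -[x]mulr1 scalerAr; exact: MM. Qed.

Lemma maximal_no_unit x : M x -> l1n (1 - x) < 1 -> False.
Proof.
by move=> Mx /neumann_rinv[w xw]; apply: M1; rewrite -xw; exact: MM.
Qed.

(** If [x] is outside [M], then x c is 1 modulo [M] for some c. Replacing x by a nearby m in [M]
    yields an element of [M] at distance less than 1 from 1, contrary to the Neumann series. *)
Lemma maximal_closed x :
  (forall e, 0 < e -> exists2 m, M m & l1n (x - m) < e) -> M x.
Proof.
move=> xM; apply: contrapT => /Mgen[c Mc].
have c1 : 0 < l1n c + 1 by rewrite ltr_wpDl ?l1n_ge0.
have [|m Mm xm] := xM (l1n c + 1)^-1; first by rewrite invr_gt0.
apply: (@maximal_no_unit (1 - x * c + m * c)); first by apply: MD => //; exact: MM.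
rewrite opprD opprB addrA [1 + _]addrC subrK -mulrBl.
apply: le_lt_trans (l1nM _ _) _.
apply: (@le_lt_trans _ _ (l1n (x - m) * (l1n c + 1))).
  by rewrite ler_wpM2l ?l1n_ge0// lerDl.
by rewrite -ltr_pdivlMr// mul1r.
Qed.

Variable z : G.
Hypothesis zC : forall h, commute z h.

Lemma delta_comm x : l1_delta R z * x = x * l1_delta R z.
Proof.
apply: l1_central => g; rewrite l1_deltaE.
by have [->//|_] := eqVneq g z; rewrite eqxx.
Qed.

(* [M] is only a right ideal, so [E] is preserved by right multiplications, and
   by left multiplications with central elements. *)
Let E x y := M (x - y).
Let Es x y : E x y -> E y x. Proof. by move=> /MN; rewrite opprB. Qed.
Let Et y x t : E x y -> E y t -> E x t.
Proof. by move=> xy yt; have := MD xy yt; rewrite addrA subrK. Qed.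
Let EM x y c : E x y -> E (x * c) (y * c).
Proof. by move=> xy; rewrite /E -mulrBl; exact: MM. Qed.
Let EC u x y : (forall c, GRing.comm u c) -> E x y -> E (u * x) (u * y).
Proof. by move=> uC xy; rewrite /E -mulrBr uC; exact: MM. Qed.
Let ED x y x' y' : E x y -> E x' y' -> E (x + x') (y + y').
Proof. by move=> xy xy'; rewrite /E opprD addrACA; exact: MD. Qed.
Let EN x y : E x y -> E (- x) (- y).
Proof. by move=> xy; rewrite /E -opprD; exact: MN. Qed.
Let EZ k x y : E x y -> E (k *: x) (k *: y).
Proof. by move=> xy; rewrite /E -scalerBr; exact: MZ. Qed.

Local Notation Z := (l1_delta R z).
Let V n (l : R[i]) : A := 1 - l *: Z ^+ n.

Let VC n l c : GRing.comm (V n l) c.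
Proof.
apply: commr_sym; apply: commrB; first exact: commr1.
rewrite /GRing.comm -scalerAr -scalerAl; congr (_ *: _).
by apply: commrX; rewrite /GRing.comm delta_comm.
Qed.

Hypothesis noM : forall l : R[i], `|l| = 1 -> ~ M (Z - l%:A).

(** 1 - l Z is -l times Z - l^-1, hence outside [M]. *)
Let Vinv l : `|l| = 1 -> exists c, E 1 (V 1 l * c).
Proof.
move=> l1; apply: Mgen => MV; apply: (noM (l := l^-1)); first by rewrite normfV l1 invr1.
have l0 : l != 0 by rewrite -normr_eq0 l1 oner_eq0.
have := MZ (- l^-1) MV; rewrite scalerBr !scaleNr opprK scalerA mulVf// scale1r expr1.
by rewrite addrC.
Qed.

(** Schur's argument: if [x] is outside [M], then x c is 1 modulo [M], so [V 1 l] is congruent to V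
    x c and lies in [M], which contradicts [Vinv]. *)
Let Vinj l x : `|l| = 1 -> M (V 1 l * x) -> M x.
Proof.
move=> l1 MV; apply: contrapT => /Mgen[c Mc]; have [d Md] := Vinv l1.
have V1 : E (V 1 l) 0.
  have := EC (VC 1 l) Mc; rewrite mulr1 mulrA => h; apply: Et h _.
  by rewrite /E subr0; exact: MM.
by apply: M1; have := Et Md (EM d V1); rewrite mul0r /E subr0.
Qed.

(** If c inverts [V 1 l] modulo [M], then c w inverts [V 1 m], where w is the Neumann series for 1 -
    (m - l) Z c, of norm at most 2. *)
Let Vloc l : `|l| = 1 -> exists K d, 0 < d /\
  forall m, nrm (m - l) < d -> exists c, E 1 (V 1 m * c) /\ l1n c <= K.
Proof.
move=> l1; have [c Mc] := Vinv l1; exists (l1n c * 2), ((l1n c + 1) * 2)^-1.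
have c0 := l1n_ge0 c; split=> [|m ml]; first by rewrite invr_gt0; lra.
pose f := (m - l) *: (Z * c).
have f2 : l1n f <= 2^-1.
  rewrite l1nZ; have Zc : l1n (Z * c) <= l1n c + 1.
    by rewrite (le_trans (l1n_deltaM _ _))// lerDl.
  apply: le_trans (ler_wpM2l (nrm_ge0 _) Zc) _.
  rewrite -ler_pdivlMr; last lra.
  by rewrite -invfM mulrC ltW.
have [w wE] := neumann (le_lt_trans f2 (ltac:(lra) : 2^-1 < 1 :> R)).
have w2 := neumann_norm f2 wE.
exists (c * w); split; last first.
  by rewrite (le_trans (l1nM _ _))// ler_wpM2l.
have -> : V 1 m * (c * w) = V 1 l * c * w - w + 1.
  have w1 : - w + 1 = - (f * w) by rewrite {1}wE [1 + _]addrC opprD subrK.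
  rewrite -(addrA (V 1 l * c * w)) w1 -mulrBl mulrA; apply: (congr1 ( *%R^~ w)).
  rewrite /V /f expr1 scalerBl !mulrBl mul1r -!scalerAl; rewrite opprB.
  by rewrite [RHS]addrA subrK.
rewrite /E [_ + 1]addrC opprD addrA subrr sub0r opprB -[X in X - _]mul1r.
exact: EM.
Qed.

Let nrm1 (l : R[i]) : `|l| = 1 -> nrm l = 1.
Proof. by rewrite nrmE => /complexI. Qed.

(** Off the circle, a disc that misses the circle makes the claim vacuous. The local bound thus
    holds at every point of the plane, and compactness of a square applies. *)
Let Vloc' l : exists K d, 0 < d /\ forall m, `|m| = 1 ->
  nrm (m - l) < d -> exists c, E 1 (V 1 m * c) /\ l1n c <= K.
Proof.
have [/Vloc[K [d [d0 Kd]]]|l1] := pselect (`|l| = 1).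
  by exists K, d; split=> // m _ /Kd.
have nl1 : nrm l != 1 by apply: contra_notN l1 => /eqP nl; rewrite nrmE nl.
exists 0, `|nrm l - 1|; split=> [|m /nrm1 m1]; first by rewrite normr_gt0 subr_eq0.
have h1 := nrmD (m - l) l; have h2 := nrmD m (l - m).
rewrite subrK m1 in h1; rewrite addrC subrK m1 (nrmB l m) in h2.
by clear l1 nl1; case: (ler0P (nrm l - 1)) => ? ?; exfalso; lra.
Qed.

(** Compactness of the square around the circle makes the local bounds uniform; [K] runs along the
    filter at infinity, where it dominates each of them. *)
Let Vunif : exists K, forall l, `|l| = 1 -> exists c, E 1 (V 1 l * c) /\ l1n c <= K.
Proof.
pose P K (p : R * R) := forall l : R[i], l = (p.1 +i* p.2)%C -> `|l| = 1 ->
  exists c, E 1 (V 1 l * c) /\ l1n c <= K.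
have cpt : compact (`[-1, 1]%classic `*` `[-1, 1]%classic : set (R * R)).
  by apply: compact_setX; exact: segment_compact.
have /filter_ex[K HK] : \forall K \near +oo, `[-1, 1]%classic `*` `[-1, 1]%classic `<=` P K.
  move/compact_near_coveringP: cpt; apply => -[x y] _.
  have [K [d [d0 Kd]]] := Vloc' (x +i* y)%C.
  exists (ball (x, y) (d / 2), [set K' | K <= K']) => /=.
    split; first by apply: nbhsx_ballx; rewrite divr_gt0.
    by apply: nbhs_pinfty_ge; rewrite num_real.
  move=> [[x' y'] K'] /= [[xx yy] KK] l -> l1.
  have [|c [Ec cK]] := Kd _ l1; last by exists c; split=> //; exact: le_trans KK.
  rewrite (le_lt_trans (nrm_le_ReIm _))//= distrC [ `|y' - y|]distrC (splitr d).
  exact: ltrD xx yy.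
exists K => l l1; apply: (HK (complex.Re l, complex.Im l)) => //; last by case: (l).
split=> /=; rewrite in_itv /= -ler_norml -[leRHS](nrm1 l1).
  exact: nrm_Re.
exact: nrm_Im.
Qed.

(** [F] consists of inverses of [V n l] modulo [M] and is Lipschitz for the quotient norm of A/M, as
    witnessed by the representatives [d]. *)
Let lip n (L : R) := exists F : R[i] -> A,
  (forall l, `|l| = 1 -> E 1 (V n l * F l)) /\
  forall l m, `|l| = 1 -> `|m| = 1 ->
    exists d, E (F l - F m) d /\ l1n d <= L * nrm (l - m).

Let lip_resolvent : exists L, 0 <= L /\ lip 1 L.
Proof.
have [K HK] := Vunif.
have /choice[F HF] l : exists c, `|l| = 1 -> E 1 (V 1 l * c) /\ l1n c <= K.
  by have [/HK[c ?]|?] := pselect (`|l| = 1); [exists c|exists 0].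
exists (K * K); split; first by rewrite -expr2 sqr_ge0.
exists F; split=> [l /HF[]//|l m l1 m1].
have [[El Kl] [Em Km]] := (HF _ l1, HF _ m1).
exists ((l - m) *: (Z * (F l * F m))); split; last first.
  rewrite l1nZ mulrC ler_wpM2r ?nrm_ge0// (le_trans (l1n_deltaM _ _))//.
  by rewrite (le_trans (l1nM _ _))// ler_pM ?l1n_ge0.
have -> : (l - m) *: (Z * (F l * F m)) = V 1 m * (F l * F m) - V 1 l * (F l * F m).
  rewrite -mulrBl scalerAl; apply: (congr1 ( *%R^~ (F l * F m))).
  by rewrite /V expr1 scalerBl opprB addrCA addrAC subrr add0r.
apply: ED; last first.
  by apply: EN; rewrite mulrA -{1}[F m]mul1r; exact: EM.
(* Left multiplication by [F l] need not preserve [M], so V_m F_l F_m and F_l are compared after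
   applying the injective V_l: since V_m is central, both then become 1 modulo [M]. *)
apply: Vinj l1 _; rewrite mulrBr; apply: (@Et 1); first exact: Es.
have -> : V 1 l * (V 1 m * (F l * F m)) = V 1 l * F l * (V 1 m * F m).
  by rewrite (mulrA (V 1 m)) (VC 1 m (F l)) -!mulrA.
by apply: (Et Em); rewrite -{1}[V 1 m * F m]mul1r; exact: EM.
Qed.

Let nrm_two : nrm (2 : R[i]) = 2.
Proof. by rewrite (_ : 2 = (2 : R)%:C%C) ?nrm_real// rmorphD. Qed.

Let nrm_half : nrm (2^-1 : R[i]) = 2^-1.
Proof. by apply: (mulfI (x := 2)) => //; rewrite -{1}nrm_two -nrmM !mulfV// nrm_real. Qed.

Let VM n s : V n s * V n (- s) = V n.*2 (s ^+ 2).
Proof.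
rewrite /V scaleNr opprK mulrBl mul1r mulrDr mulr1 -scalerAl -scalerAr scalerA.
by rewrite -exprD addnn -expr2 opprD addrA addrK.
Qed.

(** Partial fractions: 2 / (1 - t^2) = 1 / (1 - t) + 1 / (1 + t) with t = s Z^n. *)
Let V_avg n s x y : E 1 (V n s * x) -> E 1 (V n (- s) * y) ->
  E 1 (V n.*2 (s ^+ 2) * (2^-1 *: (x + y))).
Proof.
move=> Ex Ey; rewrite -scalerAr mulrDr.
have -> : 1 = 2^-1 *: (V n (- s) + V n s).
  rewrite /V scaleNr opprK addrACA subrr addr0.
  have -> : 1 + 1 = 2 *: (1 : A) by rewrite scaler_nat mulr2n.
  rewrite scalerA.
  by rewrite mulVf ?scale1r// pnatr_eq0.
apply/EZ/ED.
  rewrite -VM (VC n s) -mulrA -{1}[V n (- s)]mulr1; exact: EC.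
rewrite -VM -mulrA -{1}[V n s]mulr1; exact: EC.
Qed.

Let sqrt_circle (l : R[i]) : `|l| = 1 -> `|sqrtC l| = 1.
Proof. by move=> l1; apply/eqP; rewrite -(@pexpr_eq1 _ _ 2)// -normrX sqrtCK l1. Qed.

(* The two square roots of [l] and [m] can be paired at distance at most
   4/5 |l - m|: by the parallelogram identity |s + t|^2 + |s - t|^2 = 4, so one
   of the two factors of s^2 - t^2 is at least 5/4. *)
Let lip_double n L : 0 <= L -> lip n L -> lip n.*2 (4 / 5 * L).
Proof.
move=> L0 [F [FE FL]]; exists (fun l => 2^-1 *: (F (sqrtC l) + F (- sqrtC l))).
split=> [l l1|l m l1 m1].
  have s1 := sqrt_circle l1.
  have := V_avg (FE _ s1) (FE (- sqrtC l) _).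
  by rewrite normrN sqrtCK; exact.
have main s t : `|s| = 1 -> `|t| = 1 -> s ^+ 2 = l -> t ^+ 2 = m -> 5 / 4 <= nrm (s + t) ->
    exists d, E (2^-1 *: (F s + F (- s)) - 2^-1 *: (F t + F (- t))) d /\
      l1n d <= 4 / 5 * L * nrm (l - m).
  move=> s1 t1 sl tm st.
  have [d [Ed dL]] := FL _ _ s1 t1.
  have [|| d' [Ed' dL']] := FL (- s) (- t); rewrite ?normrN//.
  exists (2^-1 *: (d + d')); split.
    rewrite -scalerBr; apply: EZ; rewrite opprD addrACA; exact: ED.
  rewrite -opprD nrmN in dL'.
  rewrite l1nZ nrm_half; have := l1nD d d'.
  have -> : l - m = (s + t) * (s - t) by rewrite -sl -tm; ring.
  rewrite nrmM; have := nrm_ge0 (s - t); move: dL dL'.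
  set u := nrm (s - t) => dL dL' u0 dd.
  have : 5 / 4 * (L * u) <= nrm (s + t) * (L * u).
    by rewrite ler_wpM2r// mulr_ge0.
  by lra.
have [s1 t1] := (sqrt_circle l1, sqrt_circle m1).
have := nrm_parallelogram (sqrtC l) (sqrtC m); rewrite (nrm1 s1) (nrm1 t1) => par.
have [st|st] := lerP (5 / 4) (nrm (sqrtC l + sqrtC m)).
  by apply: main => //; exact: sqrtCK.
(* Here the difference of the two roots is the large factor, so the root of [l] is paired with the
   other root of [m]; the average is symmetric in the two roots. *)
rewrite [F (sqrtC m) + _]addrC -{2}[sqrtC m]opprK.
apply: main; rewrite ?normrN ?sqrrN ?sqrtCK//.
by have := nrm_ge0 (sqrtC l + sqrtC m); have := nrm_ge0 (sqrtC l - sqrtC m); nra.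
Qed.

Let lip_small e : 0 < e -> exists n, lip n e.
Proof.
move=> e0; have [L [L0 H]] := lip_resolvent.
have step p : exists n, lip n ((4 / 5) ^+ p * L).
  elim: p => [|p [n Hn]]; first by exists 1%N; rewrite mul1r.
  exists n.*2; rewrite exprS -mulrA; apply: lip_double => //.
  by rewrite mulr_ge0// exprn_ge0// divr_ge0.
have [p Hp] : exists p, (4 / 5) ^+ p * L <= e.
  have : (fun p => (4 / 5 : R) ^+ p) @ \oo --> (0 : R).
    by apply: cvg_expr; rewrite ger0_norm; lra.
  move/cvgr0_norm_lt => /(_ (e / (L + 1))).
  rewrite divr_gt0 ?ltr_wpDl// => /(_ isT)[p _ /(_ p (leqnn p))] /=.
  rewrite ger0_norm ?exprn_ge0 ?divr_ge0// ltr_pdivlMr ?ltr_wpDl// => /ltW h.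
  exists p; apply: le_trans h; rewrite ler_wpM2l ?exprn_ge0 ?divr_ge0//; lra.
have [n [F [FE FL]]] := step p; exists n, F; split=> // l m l1 m1.
have [d [Ed dL]] := FL _ _ l1 m1; exists d; split=> //.
by apply: le_trans dL _; rewrite ler_wpM2r// nrm_ge0.
Qed.

(* The resolvents F(1), F(-1) of [Z ^+ n] at 1 and -1 are close, while
   (1 - Z^2n) (F(1) - F(-1)) = 2 Z^n is far from [M]. *)
Lemma no_unitary_point_absurd : False.
Proof.
(* As 1 and -1 are at distance 2, the constant 1/8 gives [d] of norm at most 1/4. Then [v] below,
   which is 1 modulo [M], has norm at most 1/2 * 2 * 1/4 < 1. *)
have [n [F [FE FL]]] := lip_small (ltac:(lra) : 0 < 8^-1 :> R).
have [||d [Ed dL]] := FL 1 (-1); rewrite ?normrN ?normr1//.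
have {}dL : l1n d <= 4^-1.
  apply: le_trans dL _; rewrite opprK (_ : 1 + 1 = 2 :> R[i])// nrm_two; lra.
have E1 := FE 1 (normr1 _); have E2 := FE (-1) (etrans (normrN _) (normr1 _)).
pose w := l1_delta R (z ^- n)%g.
have wZ : Z ^+ n * w = 1.
  have -> : Z ^+ n = l1_delta R (z ^+ n)%g.
    by elim: (n) => [|k IH]; rewrite ?expg0 ?l1_delta1// exprS expgS l1_deltaM IH.
  by rewrite -l1_deltaM mulgV l1_delta1.
have : E (V n.*2 1 * (F 1 - F (-1))) (2 *: Z ^+ n).
  have -> : 2 *: Z ^+ n = V n (-1) * 1 - V n 1 * 1.
    by rewrite !mulr1 /V scaleNr scale1r opprD !opprK addrACA subrr add0r scaler_nat mulr2n.
  have -> : V n.*2 1 = V n 1 * V n (-1) by rewrite VM expr1n.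
  rewrite mulrBr; apply: ED.
    by rewrite (VC n 1) -mulrA; apply: EC => //; exact: Es.
  by apply: EN; rewrite -mulrA; apply: EC => //; exact: Es.
move=> /Es ZE; pose v := 2^-1 *: (V n.*2 1 * d * w).
have vE : E 1 v.
  have -> : 1 = 2^-1 *: (2 *: Z ^+ n * w).
    by rewrite -scalerAl wZ scalerA mulVf ?scale1r// pnatr_eq0.
  by apply/EZ/EM/(Et ZE)/EC.
apply: (maximal_no_unit vE); rewrite subKr.
have Zn : l1n (Z ^+ n.*2) <= 1.
  elim: (n.*2) => [|k IH]; first exact: l1n1_le.
  by rewrite exprS (le_trans (l1n_deltaM _ _)).
have Vn : l1n (V n.*2 1) <= 2.
  rewrite /V scale1r (le_trans (l1nD _ _))// l1nN.
  by have := l1n1_le R G; lra.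
have wn : l1n w <= 1 by rewrite -[w]mulr1 (le_trans (l1n_deltaM _ _))// l1n1_le.
have h1 : l1n (V n.*2 1 * d) <= 2^-1.
  apply: le_trans (l1nM _ _) _; rewrite (_ : 2^-1 = 2 * 4^-1); last by field.
  by rewrite ler_pM ?l1n_ge0.
rewrite l1nZ nrm_half; have h2 := l1nM (V n.*2 1 * d) w.
have h3 : l1n (V n.*2 1 * d) * l1n w <= 2^-1 * 1 by rewrite ler_pM ?l1n_ge0.
by lra.
Qed.

End Spectrum.

Lemma central_delta_scalar (R : realType) (G : groupType) (M : set (l1 R G)) (z : G) :
  maximal_right_ideal M -> (forall h, commute z h) ->
  exists2 l : R[i], `|l| = 1 & M (l1_delta R z - l%:A).
Proof.
move=> Mmax zC; apply: contrapT => nl.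
apply: (no_unitary_point_absurd Mmax zC) => l l1 Ml.
by apply: nl; exists l.
Qed.

(** * Approximation by finitely supported elements *)

Section FiniteApproximation.
Variables (R : realType) (G : groupType).
Local Notation A := (l1 R G).
Implicit Types (f g : A) (x y : G).
Local Open Scope fset_scope.
Local Open Scope ring_scope.

Definition l1_off f (B : {fset G}) : A := f - \sum_(x <- B) f x *: l1_delta R x.

Lemma l1_sumE (I : Type) (s : seq I) (F : I -> A) x :
  (\sum_(i <- s) F i) x = \sum_(i <- s) F i x.
Proof. by elim: s => [|i s IH]; rewrite ?big_nil// !big_cons -IH. Qed.

Lemma l1_offE f (B : {fset G}) x : l1_off f B x = if x \in B then 0 else f x.
Proof.
have -> : l1_off f B x = f x - \sum_(y <- B) f y * (x == y)%:R.
  by rewrite -(l1_sumE _ (fun y => f y *: l1_delta R y)).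
case: ifPn => xB.
  rewrite (big_rem x)//= eqxx mulr1 big_seq big1 ?addr0 ?subrr// => y.
  by rewrite mem_rem_uniq ?fset_uniq// => /andP[/= yx _]; rewrite eq_sym (negbTE yx) mulr0.
rewrite big_seq big1 ?subr0// => y yB.
by have [xy|_] := eqVneq x y; [rewrite xy yB in xB|rewrite mulr0].
Qed.

(** On every finite set the mass of the tail and the mass on [C] add up to at most |f|, while the
    mass on [C] is within [e] of |f|. *)
Lemma l1_off_small f e : 0 < e ->
  exists B, forall C : {fset G}, B `<=` C -> l1n (l1_off f C) <= e.
Proof.
move=> e0; have [B HB] := l1n_has_csum f e0; exists B => C /HB{HB}.
rewrite -rmorph_sum -rmorphB /= => /ltW /(le_trans (nrm_Re _)) /=.
rewrite ler_distl => /andP[h _]; apply: l1n_le => D.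
rewrite -(lerD2r (\sum_(x <- C) nrm (f x))).
apply: le_trans (_ : l1n f <= _); last by rewrite addrC -lerBlDr.
apply: le_trans (sum_nrm_le f (D `|` C)).
apply: (@le_trans _ _ (\sum_(x <- D `|` C) nrm (l1_off f C x) +
    \sum_(x <- D `|` C) if x \in C then nrm (f x) else 0)).
  apply: lerD; first by apply: ler_sum_fset (fsubsetUl _ _) => x; exact: nrm_ge0.
  rewrite (@eq_big_seq _ _ _ _ _ _ (fun x => if x \in C then nrm (f x) else 0)).
    by apply: ler_sum_fset (fsubsetUr _ _) => x; case: ifP => // _; exact: nrm_ge0.
  by move=> x xC; rewrite xC.
rewrite -big_split ler_sum// => x _; rewrite l1_offE.
by case: ifP => _ /=; [rewrite nrm0 add0r|rewrite addr0].
Qed.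

End FiniteApproximation.

(** * From local right inverses to a global one *)

Section Localization.
Variable R : realType.
Local Notation A := (l1 R heisenberg).
Implicit Types (f : A).
Local Open Scope fset_scope.
Local Open Scope ring_scope.

(** Induction on z^(m+1) - l^(m+1) = (z - l) z^m + l (z^m - l^m); a negative power follows on
    multiplying z^m - l^m by z^-m on the right and by the scalar -l^-m. *)
Lemma right_ideal_delta_zpow (G : groupType) (M : set (l1 R G)) (z : G) (l : R[i]) n :
  right_ideal M -> l != 0 -> M (l1_delta R z - l%:A) ->
  M (l1_delta R (zpowg z n) - (l ^ n)%:A).
Proof.
move=> [M0 MB MM] l0 Mz.
have MD x y : M x -> M y -> M (x + y).
  by move=> Mx My; rewrite -[y]opprK -[- y]sub0r; apply: (MB) => //; exact: MB.
have MZ k x : M x -> M (k *: x).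
  by move=> Mx; rewrite -[x]mulr1 scalerAr; exact: MM.
have Mnat m : M (l1_delta R (z ^+ m)%g - (l ^+ m)%:A).
  elim: m => [|m IH]; first by rewrite expg0 l1_delta1 expr0 scale1r subrr.
  rewrite expgS l1_deltaM exprS.
  rewrite -(subrK (l *: l1_delta R (z ^+ m)%g) (l1_delta R z * _)) -addrA.
  apply: MD.
    by rewrite -[X in _ *: X]mul1r scalerAl -mulrBl; exact: MM.
  by rewrite -scalerA -scalerBr; exact: MZ.
case: n => m; first exact: Mnat.
have ln0 : l ^+ m.+1 != 0 by rewrite expf_neq0.
have := MZ (- (l ^- m.+1)) _ (MM _ (l1_delta R (z ^- m.+1)%g) (Mnat m.+1)).
rewrite mulrBl -l1_deltaM mulgV l1_delta1 -scalerAl mul1r scalerBr scalerA.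
by rewrite mulNr mulVf// !scaleNr scale1r opprK addrC.
Qed.

Lemma zpow_hz02 n : zpowg hz n (inord 0) (inord 2) = n :> int.
Proof. by rewrite heis_zpow02 !hzE ?mul0r// mul1r. Qed.

(** If the sum of h_n l^n is 0, then h is the sum of the h_n (z^n - l^n), a limit of elements of the
    closed set [M]. *)
Lemma m_ideal_sub (M : set A) (l : R[i]) : maximal_right_ideal M -> `|l| = 1 ->
  M (l1_delta R hz - l%:A) -> (m_ideal l `<=` M)%classic.
Proof.
move=> Mmax l1 Mz h [hC hs].
have [[M0 MB MM] _ _] := Mmax.
have MD x y : M x -> M y -> M (x + y).
  by move=> Mx My; rewrite -[y]opprK -[- y]sub0r; apply: (MB) => //; exact: MB.
have l0 : l != 0 by rewrite -normr_eq0 l1 oner_eq0.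
(* On the center this entry is the exponent of [hz]. *)
pose k (g : heisenberg) : int := g (inord 0) (inord 2).
have kz : cancel (zpowg hz) k by exact: zpow_hz02.
have zk g : zpowg hz (k g) != g -> h g = 0.
  move=> gz; apply/eqP; apply: contraNT gz => /hC/heis_central[n ->].
  by rewrite kz.
have nl (n : int) : nrm (l ^ n) = 1.
  have /complexI : (nrm (l ^ n))%:C%C = 1%:C%C :> R[i].
    by rewrite -nrmE; case: n => m /=; rewrite ?normfV normrX l1 expr1n ?invr1.
  by [].
have hG : has_csum (fun g => h g * l ^ k g) 0.
  apply: (has_csum_inj kz) => [g /zk ->|]; first by rewrite mul0r.
  rewrite -hs; apply: (has_csum_ext (f := fun n : int => h (zpowg hz n) * l ^ n)).
    by move=> n; rewrite kz.
  apply: csummable_has_csum; apply/csummableP; exists (l1n h) => B.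
  apply: le_trans (sum_nrm_le h [fset zpowg hz n | n in B]).
  rewrite (sum_bij _ (fun g => nrm (h g)) (can_inj kz)).
  by apply: ler_sum => n _; rewrite nrmM nl mulr1.
apply: (maximal_closed Mmax) => e e0.
have e20 : 0 < e / 2 by rewrite divr_gt0.
have [B1 HB1] := l1_off_small h e20; have [B2 HB2] := hG _ e20.
pose B := B1 `|` B2.
exists (\sum_(g <- B) h g *: (l1_delta R g - (l ^ k g)%:A)).
  elim/big_ind: _ => // g _.
  have [gz|/zk ->] := eqVneq (zpowg hz (k g)) g; last by rewrite scale0r.
  rewrite -[X in _ *: X]mulr1 scalerAr; apply: MM; rewrite -{1}gz.
  by apply: right_ideal_delta_zpow => //; case: Mmax.
have -> : h - \sum_(g <- B) h g *: (l1_delta R g - (l ^ k g)%:A) =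
    l1_off h B + (\sum_(g <- B) h g * l ^ k g)%:A.
  rewrite (eq_bigr (fun g => h g *: l1_delta R g - (h g * l ^ k g)%:A)); last first.
    by move=> g _; rewrite scalerBr scalerA.
  by rewrite sumrB opprB addrCA addrC scaler_suml addrC.
apply: le_lt_trans (l1nD _ _) _; rewrite (splitr e) ler_ltD//.
  by apply: HB1; exact: fsubsetUl.
have := HB2 B (fsubsetUr _ _); rewrite subr0 l1nZ; apply: le_lt_trans.
by rewrite ler_piMr ?nrm_ge0// l1n1_le.
Qed.

(** [M] is only a right ideal, but the annihilator of A/M, the set of x with c x in [M] for all c,
    is a closed two-sided ideal inside [M]. It contains [m_ideal l], whose elements commute with
    every c. *)
Lemma J_set_sub (M : set A) (l : R[i]) : maximal_right_ideal M -> `|l| = 1 ->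
  M (l1_delta R hz - l%:A) -> (J_set l `<=` M)%classic.
Proof.
move=> Mmax l1 Mz f.
have [[M0 MB MM] _ _] := Mmax.
move=> /(_ [set x | forall c, M (c * x)]) /= H; rewrite -[f]mul1r.
apply: H; split; [split|].
- move=> x xcl c; apply: (maximal_closed Mmax) => e e0.
  have c1 : 0 < l1n c + 1 by rewrite ltr_wpDl ?l1n_ge0.
  have [|y [/= yM xy]] := xcl _ (nbhsx_ballx x (e / (l1n c + 1))%:C%C _).
    by rewrite -[0]/(0%:C%C) ltcR divr_gt0.
  exists (c * y); first exact: yM.
  move: xy; rewrite -ball_normE /= l1nE ltcR ltr_pdivlMr// => xy.
  rewrite -mulrBr; apply: le_lt_trans (l1nM _ _) _; apply: le_lt_trans xy.
  by rewrite mulrC ler_wpM2l ?l1n_ge0// lerDl.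
- split=> [c|x y Mx My c|a x Mx c|a x Mx c].
  + by rewrite mulr0.
  + by rewrite mulrBr; exact: MB.
  + by rewrite mulrA.
  + by rewrite mulrA; exact: MM.
- move=> h mh c; rewrite -l1_central; last by case: mh.
  by apply: MM; apply: m_ideal_sub mh.
Qed.

Lemma local_rinv a :
  (forall theta : R[i], `|theta| = 1 -> exists b, J_set theta (a * b - 1)) ->
  exists b, a * b = 1.
Proof.
move=> loc; apply: contrapT => /maximal_right_ideal_exists[M [Mmax Ma]].
have [[M0 MB MM] M1 _] := Mmax.
have hzC h : commute hz h.
  by apply: (iffRL (heis_central hz)); exists 1%Z; rewrite /= expg1.
have [l l1 Mz] := central_delta_scalar Mmax hzC.
have [b /(J_set_sub Mmax l1 Mz) Jb] := loc _ l1.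
by apply: M1; have := MB _ _ (MM _ b Ma) Jb; rewrite subKr.
Qed.

End Localization.

(** * Direct finiteness from residual finiteness *)

Section DirectFiniteness.
Variables (R : realType) (G : groupType).
Local Notation A := (l1 R G).
Implicit Types (f h : A) (g x y : G).
Local Open Scope fset_scope.
Local Open Scope ring_scope.

Lemma has_csum_sum (I J : choiceType) (s : seq J) (F : J -> I -> R[i]) (S : J -> R[i]) :
  (forall j, has_csum (F j) (S j)) ->
  has_csum (fun i => \sum_(j <- s) F j i) (\sum_(j <- s) S j).
Proof.
move=> FS; elim: s => [|j s IH].
  move=> e e0; exists fset0 => B _; rewrite big_nil subr0 big1 ?nrm0// => i _.
  by rewrite big_nil.
rewrite big_cons; apply: has_csum_ext (has_csumD (FS j) IH) => i.
by rewrite big_cons.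
Qed.

Definition l1_mass f (p : pred G) : R[i] := csum (fun x => f x * (p x)%:R).

Lemma l1_mass_has_csum f (p : pred G) : has_csum (fun x => f x * (p x)%:R) (l1_mass f p).
Proof.
apply: csummable_has_csum; apply: csummable_le (l1_summable f) => x.
by rewrite nrmM; case: (p x); rewrite ?nrm0 ?mulr0 ?nrm_ge0// (nrm_real (r := 1))// mulr1.
Qed.

Lemma nrm_l1_mass f p : nrm (l1_mass f p) <= l1n f.
Proof.
apply: has_csum_nrm_le (l1_mass_has_csum f p) _ => B.
apply: le_trans (sum_nrm_le f B); apply: ler_sum => x _.
by rewrite nrmM; case: (p x); rewrite ?nrm0 ?mulr0 ?nrm_ge0// (nrm_real (r := 1))// mulr1.
Qed.

Lemma l1_mass1 (p : pred G) : l1_mass 1 p = (p 1%g)%:R.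
Proof.
apply: csumE; rewrite (_ : (p 1%g)%:R = (1 : A) 1%g * (p 1%g)%:R); last first.
  by rewrite /= /l1_one_fun eqxx mul1r.
apply: (@has_csum1 _ _ (fun x => (1 : A) x * (p x)%:R)) => x /negbTE x1.
by rewrite /= /l1_one_fun x1 mul0r.
Qed.

Section Representation.
Variables (n : nat) (act : G -> 'I_n -> 'I_n).
Hypothesis act1 : forall t, act 1%g t = t.
Hypothesis actM : forall x y t, act (x * y)%g t = act x (act y t).

(** The permutation representation extended to l^1, transposed: the row index is the source of the
    action, so products are reversed. *)
Definition l1_mx f : 'M[R[i]]_n :=
  \matrix_(s, t) l1_mass f (fun x => act x s == t).

Lemma l1_mx1 : l1_mx 1 = 1%:M.
Proof. by apply/matrixP => s t; rewrite !mxE l1_mass1 act1. Qed.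

Lemma l1_mxM f h : l1_mx (f * h) = l1_mx h *m l1_mx f.
Proof.
apply/matrixP => s t; rewrite !mxE.
pose F (u x : G) := f u * h (u^-1 * x)%g * (act x s == t)%:R.
have FS : csummable (fun p => F p.1 p.2).
  apply: csummable_le (l1_pair_summable f h) => -[u x] /=; rewrite /F nrmM.
  by case: eqP => _; rewrite ?nrm0 ?mulr0 ?nrm_ge0// (nrm_real (r := 1))// mulr1.
have row u : has_csum (F u) (\sum_r f u * (act u r == t)%:R * l1_mx h s r).
  apply: (has_csum_bij (h := fun v => (u * v)%g) (k := fun v => (u^-1 * v)%g)).
  - exact: mulKg.
  - exact: mulVKg.
  apply: (has_csum_ext (f := fun v =>
     \sum_r f u * (act u r == t)%:R * (h v * (act v s == r)%:R))).
    move=> v; rewrite /F mulKg actM (bigD1 (act v s))//= eqxx mulr1 big1 ?addr0.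
      by rewrite mulrAC.
    by move=> r /negbTE rv; rewrite (eq_sym (act v s)) rv !mulr0.
  apply: (@has_csum_sum _ _ _ (fun r v => f u * (act u r == t)%:R * (h v * (act v s == r)%:R))) => r.
  by rewrite mxE; apply: has_csumZ; exact: l1_mass_has_csum.
have col x : has_csum (F^~ x) ((f * h) x * (act x s == t)%:R).
  rewrite mulrC; apply: has_csum_ext (has_csumZ _ (l1_mul_hasE f h x)) => u.
  by rewrite mulrC.
have [S [Hr Hc]] := has_csum_fubini2 FS row col.
rewrite (has_csum_uniq (l1_mass_has_csum (f * h) _) Hc); apply: has_csum_uniq Hr _.
apply: (has_csum_ext (f := fun u => \sum_r l1_mx h s r * (f u * (act u r == t)%:R))).
  by move=> u; apply: eq_bigr => r _; rewrite mulrC.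
apply: (@has_csum_sum _ _ _ (fun r u => l1_mx h s r * (f u * (act u r == t)%:R))) => r.
by apply: has_csumZ; rewrite mxE; exact: l1_mass_has_csum.
Qed.

Lemma l1_mx_comm1 f h : f * h = 1 -> l1_mx (h * f) = 1%:M.
Proof.
move=> fh; rewrite l1_mxM; by apply: mulmx1C; rewrite -l1_mxM fh l1_mx1.
Qed.

End Representation.

(** Finite quotients are replaced by finite actions with a point whose orbit map is injective on
    [B]; a finite quotient acting on itself by translation, with the point 1, is an instance. *)
Definition residually_finite := forall B : {fset G},
  exists (T : finType) (act : G -> T -> T) (t : T),
    [/\ forall s, act 1%g s = s, forall x y s, act (x * y)%g s = act x (act y s)
      & {in B &, injective (act^~ t)}].

(** Every finite permutation representation kills d = h f - 1. If the action separates the points of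
    [B], which contains g, its matrix entry from t0 to g t0 is d(g) plus a mass of the tail of d
    outside [B], so |d(g)| <= e. *)
Lemma l1_directly_finite f h : residually_finite -> f * h = 1 -> h * f = 1.
Proof.
move=> rf fh; apply/eqP; rewrite -subr_eq0; apply/eqP/l1_ext => g.
set d := h * f - 1; apply: nrm_eq0; apply/eqP; rewrite eq_le nrm_ge0 andbT.
apply/ler_addgt0Pr => e e0; rewrite add0r.
have [B0 HB] := l1_off_small d e0; pose B := [fset g] `|` B0.
have [T [act [t0 [act1 actM actI]]]] := rf B.
pose act' x (i : 'I_#|T|) := enum_rank (act x (enum_val i)).
have act'1 i : act' 1%g i = i by rewrite /act' act1 enum_valK.
have act'M x y i : act' (x * y)%g i = act' x (act' y i).
  by rewrite /act' actM enum_rankK.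
pose p x := act' x (enum_rank t0) == act' g (enum_rank t0).
have pE x : x \in B -> p x = (x == g).
  move=> xB; apply/eqP/eqP => [|->//] /enum_rank_inj; rewrite enum_rankK => xg.
  by apply: actI => //; rewrite !inE eqxx.
have d0 : has_csum (fun x => d x * (p x)%:R) 0.
  have /matrixP/(_ (enum_rank t0) (act' g (enum_rank t0))) := l1_mx_comm1 act'1 act'M fh.
  rewrite -(l1_mx1 act'1) !mxE => hfE.
  have := has_csumD (l1_mass_has_csum (h * f) p) (has_csumZ (-1) (l1_mass_has_csum 1 p)).
  rewrite mulN1r /p hfE subrr; apply: has_csum_ext => x.
  by rewrite mulrA -mulrDl mulN1r.
have gd : has_csum (fun x => if x == g then d g else 0) (d g).
  have := @has_csum1 _ _ (fun x => if x == g then d g else 0 : R[i]) g.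
  by rewrite eqxx; apply => x /negbTE ->.
have := has_csumD gd (l1_mass_has_csum (l1_off d B) p).
move/(has_csum_ext (g := fun x => d x * (p x)%:R)) => /(_ _)/(has_csum_uniq d0) dE.
have -> : d g = - l1_mass (l1_off d B) p.
  apply/eqP; rewrite -addr_eq0 -dE// => x; rewrite l1_offE.
  have [xB|xB] := boolP (x \in B); last first.
    have [xg|_] := eqVneq x g; last by rewrite add0r.
    by rewrite xg !inE eqxx in xB.
  by rewrite mul0r addr0 pE//; have [->|_] := eqVneq x g; rewrite ?mulr1 ?mulr0.
rewrite nrmN; apply: le_trans (nrm_l1_mass _ _) _; apply: HB.
exact: fsubsetUr.
Qed.

End DirectFiniteness.

(** * Residual finiteness of the Heisenberg group *)

Lemma intr_Zp_eq0 (n : nat) (x : int) : (1 < n)%N -> (`|x| < n)%N ->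
  x%:~R = 0 :> 'Z_n -> x = 0.
Proof.
move=> n1 xn.
have absE : (`|x|%N)%:R = 0 :> 'Z_n -> x = 0.
  move/(congr1 (@nat_of_ord _)); rewrite val_Zp_nat//= modn_small// => /eqP.
  by rewrite absz_eq0 => /eqP.
case: (intP x) absE => [//|m|m] absE; move=> H; apply: absE.
  exact: H.
by move/eqP: H; rewrite rmorphN /= oppr_eq0 => /eqP.
Qed.

(** The group acts on matrices over Z/n by left multiplication, and the orbit map of the identity
    matrix is reduction modulo n, injective on [B] for large n. *)
Lemma heisenberg_residually_finite : residually_finite heisenberg.
Proof.
move=> B.
pose N := (\sum_(g <- B) \sum_i \sum_j `|(g : heisenberg) i j|)%N.
have entry_le g i j : g \in B -> (`|g i j| <= N)%N.
  move=> gB; rewrite /N (big_rem g)//= (bigD1 i)//= (bigD1 j)//=.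
  by rewrite -!addnA leq_addr.
(* Differences of entries are at most 2 N in absolute value, hence less than [n]; moreover [n] is at
   least 2, so that ['Z_n] is Z/n. *)
pose n := N.*2.+2.
exists 'M['Z_n]_3, (fun g t => map_mx (intr : int -> 'Z_n) (heis_mx g) *m t), 1%:M.
split=> [t|x y t|x y xB yB].
- by rewrite map_mx1 mul1mx.
- by rewrite map_mxM mulmxA.
rewrite !mulmx1 => xy; apply/val_inj/matrixP => i j.
apply/eqP; rewrite -subr_eq0; apply/eqP; apply: (@intr_Zp_eq0 n) => //.
  have := entry_le _ i j xB; have := entry_le _ i j yB; rewrite /n /=; lia.
have /matrixP/(_ i j) := xy; rewrite !mxE => xyij.
by rewrite rmorphB /= xyij subrr.
Qed.

(** * The local criterion for invertibility *)

Theorem corollary3p4 (R : realType) (a : l1 R heisenberg) :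
  [/\ (a \is a GRing.unit) <->
        (forall theta : R[i], `|theta| = 1 ->
          exists b : l1 R heisenberg,
            \pi_(quot_ring (J_ideal theta)) a * \pi_(quot_ring (J_ideal theta)) b
            = \pi_(quot_ring (J_ideal theta)) 1),
      (forall (theta : R[i]) (b : l1 R heisenberg), `|theta| = 1 ->
        (\pi_(quot_ring (J_ideal theta)) a * \pi_(quot_ring (J_ideal theta)) b
         = \pi_(quot_ring (J_ideal theta)) 1)
        <-> (a * b - 1 \in J_ideal theta)) &
      (forall theta : R[i], `|theta| = 1 ->
        (exists b : l1 R heisenberg,
           \pi_(quot_ring (J_ideal theta)) a * \pi_(quot_ring (J_ideal theta)) b
           = \pi_(quot_ring (J_ideal theta)) 1)
        <-> (1 \in [set a * b + j | b in [set: l1 R heisenberg]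
                                 & j in [set` J_ideal theta]]))].
Proof.
have piM theta b : \pi_(quot_ring (J_ideal theta)) a * \pi_(quot_ring (J_ideal theta)) b
    = \pi_(quot_ring (J_ideal theta)) 1 <-> a * b - 1 \in J_ideal theta.
  rewrite Quotient.idealrBE -[X in X = _]/(quot_mul _ _) quot_mulE.
  by split=> [->|/eqP].
split=> [|theta b _|theta _]; last first.
- split=> [[b /piM abJ]|].
    apply/mem_set; exists b => //; exists (1 - a * b); last by rewrite addrC subrK.
    by rewrite /= -opprB rpredN.
  move=> /set_mem[b _ [j /= jJ ab1]]; exists b; apply/piM.
  by rewrite -ab1 opprD addrA subrr sub0r rpredN.
- exact: piM.
split=> [au theta _|loc].
  by exists a^-1; apply/piM; rewrite divrr// subrr rpred0.
have [|b ab] := @local_rinv R a.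
  by move=> theta /loc[b /piM /asboolP Jb]; exists b.
apply/asboolP; exists b; split=> //.
exact: l1_directly_finite heisenberg_residually_finite ab.
Qed.
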